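(* Let $\varepsilon>0$. (1) The gradient flow for $$E_{1,\varepsilon}(A)=\int_\Omega\frac12\|\nabla A\|_F^2+\frac1{2\varepsilon^2}\operatorname{dist}^2(O_n,A)\,dx$$ is $$\partial_tA=-\nabla_AE_{1,\varepsilon}(A)=\Delta A-\varepsilon^{-2}U(\Sigma-I_n)V^t,\qquad A=U\Sigma V^t,$$ and is defined provided $A$ is non-singular almost everywhere. (2) The gradient flow for $$E_{2,\varepsilon}(A)=\int_\Omega\frac12\|\nabla A\|_F^2+\frac1{4\varepsilon^2}\|A^tA-I_n\|_F^2\,dx$$ is $$\partial_tA=-\nabla_AE_{2,\varepsilon}(A)=\Delta A-\varepsilon^{-2}U(\Sigma^2-I_n)\Sigma V^t,\qquad A=U\Sigma V^t.$$
   Context: $\Omega$ is a flat torus or, more generally, a closed Riemannian manifold; $M_n=\mathbb R^{n\times n}$; $O_n\subset M_n$ is the group of orthogonal matrices; $I_n$ is the identity. The energies are defined for $A\in H^1(\Omega,M_n)$. $\|\cdot\|_F$ is the Frobenius norm, induced by $\langle A,B\rangle_F=\sum_{i,j}A_{ij}B_{ij}$; $\operatorname{dist}^2(O_n,A)=\min_{B\in O_n}\|B-A\|_F^2$. The gradient $\nabla A$ and Laplacian $\Delta A$ of a matrix field are taken entrywise (values in the Euclidean space $M_n$). $A=U\Sigma V^t$ denotes a pointwise singular value decomposition ($U,V$ orthogonal, $\Sigma$ diagonal with non-negative entries). $\nabla_A E$ denotes the gradient of the energy with respect to the $L^2(\Omega,M_n)$ inner product $\int_\Omega\langle\cdot,\cdot\rangle_F\,dx$;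 the contribution of the penalty term is the pointwise gradient, with respect to the matrix variable and the Frobenius inner product, of its integrand. *)

(* Defs.v *)
From mathcomp Require Import all_boot all_order all_algebra.
From mathcomp Require Import all_classical all_reals all_analysis.
Set Implicit Arguments.
Unset Strict Implicit.
Unset Printing Implicit Defensive.
Import Order.TTheory GRing.Theory Num.Theory.
Import numFieldNormedType.Exports.

Local Open Scope classical_set_scope.
Local Open Scope ring_scope.

(** * Calculus on R^d *)

Section euclidean.
Context {R : realType}.

(* The partial derivative of [f] in the [k]-th coordinate direction. *)
Definition partial {d} (k : 'I_d) (f : 'rV[R]_d -> R) : 'rV[R]_d -> R :=
  'D_(delta_mx 0 k) f.

(* [O] is meant to be open. *)
Fixpoint Ck_on {d} (m : nat) (O : set 'rV[R]_d) (f : 'rV[R]_d -> R) : Prop :=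
  (forall x, O x -> {for x, continuous f}) /\
  if m is m'.+1 then
    forall k : 'I_d, (forall x, O x -> derivable f x (delta_mx 0 k)) /\
                     Ck_on m' O (partial k f)
  else True.

Definition smooth_on {d} (O : set 'rV[R]_d) (f : 'rV[R]_d -> R) : Prop :=
  forall m, Ck_on m O f.

(* Lebesgue integral over R^d of a nonnegative Borel function, as an iterated
   one-dimensional integral (Tonelli). *)
Fixpoint lebesgue_int {d} : ('rV[R]_d -> \bar R) -> \bar R :=
  match d with
  | 0 => fun f => f 0
  | d'.+1 => fun f =>
      (\int[@lebesgue_measure R]_(t in setT)
          lebesgue_int (fun y : 'rV[R]_d' => f (row_mx (t%:M : 'M[R]_1) y)))%E
  end.

End euclidean.

(** * Closed Riemannian manifolds *)

(* A topological space with its Borel sigma-algebra. *)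
Notation borelT T := (g_sigma_algebraType (@open T)).

(* Tangent vectors are row vectors of components: under a change from chart i
   to chart j the components are multiplied on the right by the Jacobian
   ['J (phi j \o psi i)].
   No second-countability axiom: it follows from compactness. *)
Record closedRiemannianManifold (R : realType) (d : nat) := {
  space :> ptopologicalType ;
  atlas : Type ;
  dom : atlas -> set space ;
  phi : atlas -> space -> 'rV[R]_d ;
  psi : atlas -> 'rV[R]_d -> space ;
  metric : atlas -> 'rV[R]_d -> 'M[R]_d ;
  vol : {measure set (borelT space) -> \bar R} ;
  space_compact : compact [set: space] ;
  space_hausdorff : hausdorff_space space ;
  dom_cover : forall p, exists i, dom i p ;
  dom_open : forall i, open (dom i) ;
  phi_open : forall i, open (phi i @` dom i) ;
  phiK : forall i p, dom i p -> psi i (phi i p) = p ;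
  phi_continuous : forall i p, dom i p -> {for p, continuous (phi i)} ;
  psi_continuous :
    forall i x, (phi i @` dom i) x -> {for x, continuous (psi i)} ;
  transition_smooth : forall i j k,
    smooth_on (phi i @` (dom i `&` dom j)) (fun x => phi j (psi i x) 0 k) ;
  metric_smooth : forall i k l,
    smooth_on (phi i @` dom i) (fun x => metric i x k l) ;
  metric_sym : forall i x, (phi i @` dom i) x -> (metric i x)^T = metric i x ;
  metric_posdef : forall i x, (phi i @` dom i) x ->
    forall v : 'rV[R]_d, v != 0 -> 0 < (v *m metric i x *m v^T) 0 0 ;
  metric_compat : forall i j p, dom i p -> dom j p ->
    let J := 'J (phi j \o psi i) (phi i p) in
    metric i (phi i p) = J *m metric j (phi j p) *m J^T ;
  vol_chart : forall i (B : set (borelT space)),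
    measurable B -> B `<=` dom i ->
    vol B = lebesgue_int (fun x =>
      (\1_(phi i @` B) x * Num.sqrt (\det (metric i x)))%:E)
}.

Section manifold.
Context {R : realType} {d : nat} (M : closedRiemannianManifold R d).
Local Notation vol := (vol M).

(* Some chart around [p]; it is only used to evaluate quantities that do not
   depend on the chart. *)
Definition chart_at (p : M) : atlas M := projT1 (cid (dom_cover p)).

Definition smooth_fun (b : M -> R) : Prop :=
  forall i, smooth_on (phi i @` dom i) (b \o @psi _ _ M i).

(* A vector field is given by its components in every chart; the values
   [X i p] for [p] outside [dom i] are irrelevant. *)
Definition vfield : Type := atlas M -> M -> 'rV[R]_d.

Definition is_vfield (X : vfield) : Prop := forall i j p, dom i p -> dom j p ->
  X j p = X i p *m 'J (phi j \o @psi _ _ M i) (phi i p).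

Definition smooth_vfield (X : vfield) : Prop := is_vfield X /\
  forall i k, smooth_on (phi i @` dom i) (fun x => X i (psi i x) 0 k).

Definition inner (X Y : vfield) (p : M) : R :=
  let i := chart_at p in (X i p *m metric i (phi i p) *m (Y i p)^T) 0 0.

Definition grad (b : M -> R) : vfield := fun i p =>
  (\row_k partial k (b \o psi i) (phi i p)) *m invmx (metric i (phi i p)).

Definition div (X : vfield) (p : M) : R :=
  let i := chart_at p in
  let rho x := Num.sqrt (\det (metric i x)) in
  (rho (phi i p))^-1 *
  \sum_(k < d) partial k (fun x => rho x * X i (psi i x) 0 k) (phi i p).

(* Laplace-Beltrami operator *)
Definition laplacian (b : M -> R) : M -> R := div (grad b).

(** ** Sobolev space and distributional Laplacian *)

Definition L2 (f : borelT M -> R) : Prop := f \in Lfun vol 2%:E.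

Definition L2_vfield (X : vfield) : Prop :=
  [/\ is_vfield X,
      forall i k, measurable_fun (dom i : set (borelT M)) (fun p => X i p 0 k) &
      (\int[vol]_p (inner X X p)%:E < +oo)%E ].

Definition weak_grad (f : borelT M -> R) (Df : vfield) : Prop :=
  forall X, smooth_vfield X ->
    \int[vol]_p inner Df X p = - \int[vol]_p (f p * div X p).

(* [f] is in H^1, with weak gradient [Df]. The weak gradient is unique up to
   null sets; an element of H^1 is represented by the pair [(f, Df)]. *)
Definition H1 (f : borelT M -> R) (Df : vfield) : Prop :=
  [/\ L2 f, L2_vfield Df & weak_grad f Df].

(* [l] is the Laplacian of [f] in the sense of distributions. *)
Definition distr_laplacian (f l : borelT M -> R) : Prop :=
  vol.-integrable setT (EFin \o l) /\
  forall b, smooth_fun b ->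
    \int[vol]_p (f p * laplacian b p) = \int[vol]_p (l p * b p).

End manifold.
Arguments grad {R d M}.
Arguments laplacian {R d M}.
Arguments smooth_fun {R d M}.
Arguments L2 {R d M}.
Arguments H1 {R d M}.
Arguments distr_laplacian {R d M}.

(** * Matrices *)

Section matrices.
Context {R : realType} {n : nat}.
Implicit Types A B U V : 'M[R]_n.

Definition frob A B : R := \sum_i \sum_j A i j * B i j.

Definition orthogonal_mx U : Prop := U *m U^T = 1%:M.

(* The infimum is a minimum, the orthogonal group being compact. *)
Definition dist2_On A : R :=
  inf [set frob (B - A) (B - A) | B in [set B | orthogonal_mx B]].

(* [A = U Sigma V^t] is a singular value decomposition, Sigma having diagonal
   [s]. *)
Definition is_svd A U (s : 'rV[R]_n) V : Prop :=
  [/\ orthogonal_mx U, orthogonal_mx V, forall i, 0 <= s 0 i &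
      A = U *m diag_mx s *m V^T].

(* [G] is the gradient of [W] at [A] for the Frobenius inner product. *)
Definition is_gradient (W : 'M[R]_n -> R) A G : Prop :=
  is_diff A W (frob G).

Definition W1 (eps : R) A : R := (2 * eps ^+ 2)^-1 * dist2_On A.

Definition W2 (eps : R) A : R :=
  (4 * eps ^+ 2)^-1 * frob (A^T *m A - 1%:M) (A^T *m A - 1%:M).

End matrices.

(** * Energies of matrix fields and their gradient flows *)

Section matrix_fields.
Context {R : realType} {d : nat} {M : closedRiemannianManifold R d} {n : nat}.
Local Notation vol := (vol M).

Definition mfield : Type := borelT M -> 'M[R]_n.
Definition mgradient : Type := 'I_n -> 'I_n -> vfield M.

Definition smooth_mx (B : mfield) : Prop :=
  forall i j, smooth_fun (fun x => B x i j).
Definition grad_mx (B : mfield) : mgradient :=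
  fun i j => grad (fun x => B x i j).
Definition integrable_mx (A : mfield) : Prop :=
  forall i j, vol.-integrable setT (fun x => (A x i j)%:E).
Definition L2_mx (A : mfield) : Prop := forall i j, L2 (fun x => A x i j).
Definition H1_mx (A : mfield) (DA : mgradient) : Prop :=
  forall i j, H1 (fun x => A x i j) (DA i j).
Definition distr_laplacian_mx (A L : mfield) : Prop :=
  forall i j, distr_laplacian (fun x => A x i j) (fun x => L x i j).

(* [int <A, Delta B>_F]: the distribution [Delta A] applied to the smooth
   field [B]. *)
Definition distr_laplacian_pairing (A B : mfield) : R :=
  \sum_i \sum_j \int[vol]_x (A x i j * laplacian (fun y => B y i j) x).

Definition energy (W : 'M[R]_n -> R) (A : mfield) (DA : mgradient) : \bar R :=
  (\int[vol]_x
     (2^-1 * (\sum_i \sum_j inner (DA i j) (DA i j) x) + W (A x))%:E)%E.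

Definition E1 (eps : R) := energy (W1 eps).
Definition E2 (eps : R) := energy (W2 eps).

(* [s |-> E (A + s B)] for a smooth direction [B] *)
Definition along (E : mfield -> mgradient -> \bar R)
    (A : mfield) (DA : mgradient) (B : mfield) (s : R) : \bar R :=
  E (fun x => A x + s *: B x)
    (fun i j c p => DA i j c p + s *: grad_mx B i j c p).

Definition first_variation E A DA B (l : R) : Prop :=
  (\forall s \near (0 : R), along E A DA B s \is a fin_num) /\
  is_derive (0 : R) 1 (fun s => fine (along E A DA B s)) l.

(* [G] is the gradient of [E] at [A] with respect to the L^2 inner product,
   whose densely many test directions are the smooth fields. *)
Definition is_L2_gradient E A DA (G : mfield) : Prop :=
  L2_mx G /\
  forall B, smooth_mx B ->
    first_variation E A DA B (\int[vol]_x frob (G x) (B x)).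

(* [V] is the derivative at time [t] of the L^2-valued curve [A]. *)
Definition time_derivative (A : R -> mfield) (t : R) (V : mfield) : Prop :=
  L2_mx V /\
  (let Q h x := h^-1 *: (A (t + h) x - A t x) - V x in
   (fun h => \int[vol]_x (frob (Q h x) (Q h x))%:E)%E @ 0^' --> 0%E).

(* [A] solves [d_t A = - grad_A E (A)] on the time interval [J]. *)
Definition gradient_flow E (J : set R) (A : R -> mfield) (DA : R -> mgradient)
    : Prop :=
  forall t, J t -> exists V, time_derivative A t V /\
    is_L2_gradient E (A t) (DA t) (fun x => - V x).

End matrix_fields.
Arguments mfield {R d} M n.
Arguments mgradient {R d} M n.

(* Main.v *)
(** The squared distance to [O_n] is attained at the polar factor [Q = U V^T] of
    [A = U S V^T], and for nonsingular [A] the function [B |-> <Q - B, A>] is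
    coercive in [Q - B] on orthogonal matrices; comparing competitors gives
    [dist^2(A + H) = dist^2(A) + 2 <A - Q, H> + O(|H|^2)]. The second penalty is
    a quartic polynomial. Both potentials [W] satisfy
    [|W(A + H) - W(A)| <= c (1 + |A| + |H|)^k |H|] with [(1 + |A|)^k] integrable,
    so the energies may be differentiated under the integral by dominated
    convergence. The Dirichlet part is quadratic, and its cross term
    [int <DA, grad B>] equals [- int <A, Delta B>] because the gradient of a
    smooth function is an admissible test field for the weak gradient of [A].
    Hence [G] is an L^2 gradient with penalty gradient [P] exactly when
    [L = P - G] is the distributional Laplacian of [A]. *)

Require Import Defs.
From HB Require Import structures.
From mathcomp Require Import all_boot all_order all_algebra.
From mathcomp Require finmap.
From mathcomp Require Import all_classical all_reals all_analysis.
From mathcomp Require Import measurable_realfun ring lra zify.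
Import Order.TTheory GRing.Theory Num.Theory.
Import numFieldNormedType.Exports.
Local Open Scope classical_set_scope.
Local Open Scope ring_scope.
Set Implicit Arguments.
Unset Strict Implicit.
Unset Printing Implicit Defensive.

(** * Orthogonal matrices and singular values *)

(** No singular value decomposition is ever selected measurably in x. The penalty gradient is a
    field of pointwise gradients, measurable as a limit of difference quotients of the penalty; the
    formula in U, Sigma, V is attached afterwards through uniqueness of the gradient. Existence of
    decompositions is still essential: a condition on all decompositions of A(x) would be empty
    without one.

    The first penalty is not differentiable at singular matrices, yet its growth bound holds at
    every matrix. Dominated convergence asks for the bound everywhere and for the derivative only
    almost everywhere, and this is where almost everywhere nonsingularity enters. For the second
    penalty the obstacle is integrability: its gradient is cubic in A, beyond what H^1 gives in high
    dimension, and finite energy supplies the missing control because the penalty dominates the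
    fourth power of A.

    On the manifold, pointwise quantities use a chart chosen at each point with no regularity in the
    choice. They are therefore compared locally with one fixed chart, and compactness reduces global
    statements to finitely many charts. *)

Lemma continuous_mulmx {R : realType} (T : topologicalType) (m n p : nat)
    (f : T -> 'M[R]_(m, n)) (g : T -> 'M[R]_(n, p)) :
  (forall i j, continuous (fun x => f x i j)) ->
  (forall i j, continuous (fun x => g x i j)) ->
  forall i j, continuous (fun x => (f x *m g x) i j).
Proof.
move=> cf cg i j; under eq_fun do rewrite mxE.
apply: continuous_big => [|k _ x]; first exact: add_continuous.
by apply: continuousM; [exact: cf|exact: cg].
Qed.

Section orthogonal_matrices.
Context {R : realType} {n : nat}.
Implicit Types A B U V : 'M[R]_n.

Lemma frobE A B : frob A B = \tr (A *m B^T).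
Proof.
rewrite /frob /mxtrace; apply: eq_bigr => i _; rewrite mxE.
by apply: eq_bigr => j _; rewrite mxE.
Qed.

Lemma frobC A B : frob A B = frob B A.
Proof.
by rewrite /frob; do 2![apply: eq_bigr => ? _]; rewrite mulrC.
Qed.

Lemma orthogonal_mxP U : orthogonal_mx U <-> U^T *m U = 1%:M.
Proof. by rewrite /orthogonal_mx; split => /mulmx1C. Qed.

Lemma orthogonal_mx_tr U : orthogonal_mx U -> orthogonal_mx U^T.
Proof. by move=> /orthogonal_mxP; rewrite /orthogonal_mx trmxK. Qed.

Lemma orthogonal_mx1 : orthogonal_mx (1%:M : 'M[R]_n).
Proof. by rewrite /orthogonal_mx trmx1 mulmx1. Qed.

Lemma orthogonal_mxM U V :
  orthogonal_mx U -> orthogonal_mx V -> orthogonal_mx (U *m V).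
Proof.
move=> hU hV; rewrite /orthogonal_mx trmx_mul -mulmxA (mulmxA V) hV mul1mx.
exact: hU.
Qed.

Definition plane_rotation (c s : R) (i j : 'I_n) : 'M[R]_n :=
  1%:M + (c - 1) *: (delta_mx i i + delta_mx j j)
  + s *: (delta_mx i j - delta_mx j i).

(** [P] is the projection onto a coordinate plane and [K] the quarter turn in it. Since
    [K *m K = - P], the product with the transpose collapses to 1 + (c^2 + s^2 - 1) P. *)
Lemma plane_rotation_orthogonal (c s : R) (i j : 'I_n) :
  i != j -> c ^+ 2 + s ^+ 2 = 1 -> orthogonal_mx (plane_rotation c s i j).
Proof.
move=> ij cs; rewrite /orthogonal_mx /plane_rotation.
set P := _ + delta_mx j j; set K := _ - delta_mx j i.
have trP : P^T = P by rewrite /P linearD /= !trmx_delta.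
have trK : K^T = - K by rewrite /K linearB /= !trmx_delta opprB.
have ji : j != i by rewrite eq_sym.
have PP : P *m P = P.
  rewrite /P !mulmxDl !mulmxDr !mul_delta_mx_cond !eqxx (negbTE ij) (negbTE ji).
  by rewrite !mulr0n !mulr1n addr0 add0r.
have PK : P *m K = K.
  rewrite /P /K !mulmxDl !mulmxBr !mul_delta_mx_cond !eqxx (negbTE ij).
  by rewrite (negbTE ji) !mulr0n !mulr1n subr0 sub0r.
have KP : K *m P = K.
  by apply: trmx_inj; rewrite trmx_mul trP trK mulmxN PK.
have KK : K *m K = - P.
  rewrite /P /K !mulmxBl !mulmxBr !mul_delta_mx_cond !eqxx (negbTE ij).
  by rewrite (negbTE ji) !mulr0n !mulr1n subr0 sub0r opprD.
clearbody P K; rewrite !linearD /= !linearZ /= trmx1 trP trK.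
rewrite !mulmxDl !mul1mx !mulmx1 !mulmxN -!scalemxAl.
rewrite PP PK KP KK.
transitivity (1%:M + (c ^+ 2 + s ^+ 2 - 1) *: P); last first.
  by rewrite cs subrr scale0r addr0.
move: (1%:M) P K {trP trK PP PK KP KK} => I P K.
by apply/matrixP => k l; rewrite !mxE; ring.
Qed.

(* Perturb along the rational parametrization of the circle. *)
Lemma rotation_stationary (c : 'rV[R]_n) (M : 'M[R]_n) :
  (forall Q, orthogonal_mx Q ->
     \tr (diag_mx c *m Q^T *m M) <= \tr (diag_mx c *m M)) ->
  forall i j, i != j -> c 0 i * M j i = c 0 j * M i j.
Proof.
move=> H i j ij.
pose a := c 0 i * M i i + c 0 j * M j j.
pose b := c 0 i * M j i - c 0 j * M i j.
have trE k l : \tr (diag_mx c *m (delta_mx k l *m M)) = c 0 k * M l k.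
  rewrite /mxtrace (bigD1 k) //= big1 ?addr0.
    rewrite mul_diag_mx mxE mxE (bigD1 l) //= big1 ?addr0.
      by rewrite mxE !eqxx mul1r.
    by move=> m /negbTE ml; rewrite mxE ml andbF mul0r.
  move=> m /negbTE ml; rewrite mul_diag_mx mxE mxE big1 ?mulr0// => p _.
  by rewrite mxE ml mul0r.
(* The rotation with cosine (1 - t^2)/(1 + t^2) and sine 2t/(1 + t^2) changes the trace by -2 (t^2 a
   + t b)/(1 + t^2), which maximality makes nonpositive. *)
have key t : 0 <= t ^+ 2 * a + t * b.
  have t1 : 0 < 1 + t ^+ 2 by rewrite ltr_pwDl// sqr_ge0.
  have circ : ((1 - t ^+ 2) / (1 + t ^+ 2)) ^+ 2
      + (2 * t / (1 + t ^+ 2)) ^+ 2 = 1.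
    by field; rewrite gt_eqF.
  have := H _ (plane_rotation_orthogonal ij circ); rewrite /plane_rotation.
  set u := (1 - t ^+ 2) / (1 + t ^+ 2) - 1; set v := 2 * t / (1 + t ^+ 2).
  have -> : (1%:M + u *: (delta_mx i i + delta_mx j j)
      + v *: (delta_mx i j - delta_mx j i))^T = 1%:M
     + u *: (delta_mx i i + delta_mx j j) - v *: (delta_mx i j - delta_mx j i)
      :> 'M[R]_n.
    apply/matrixP => k l; rewrite !mxE [l == k]eq_sym.
    by case: (k == i); case: (l == i); case: (k == j); case: (l == j) => /=; ring.
  rewrite -mulmxA !mulmxDl mul1mx mulNmx -!scalemxAl !mulmxDl mulNmx.
  rewrite !mulmxDr mulmxN -!scalemxAr !mulmxDr mulmxN.
  rewrite scalerBr !raddfD /= !raddfN /= !linearZ /= !trE => h.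
  have aux (T p q r' s' u' v' : R) :
      T + (u' * p + u' * q) + (v' * - r' + v' * - - s') <= T ->
      u' * (p + q) - v' * (r' - s') <= 0 by lra.
  have {h} := aux _ _ _ _ _ _ _ h; rewrite -/a -/b.
  have -> : u * a - v * b = - (2 * (t ^+ 2 * a + t * b)) / (1 + t ^+ 2).
    by rewrite /u /v; field; rewrite gt_eqF.
  by rewrite pmulr_lle0 ?invr_gt0// oppr_le0 pmulr_rge0.
suff : b = 0 by move/eqP; rewrite subr_eq0 => /eqP.
have [a0|a0] := eqVneq a 0.
  by have := key 1; have := key (-1); rewrite a0; lra.
(* At t = -b/k the polynomial equals (a - k)(b/k)^2, which is negative unless b = 0 because a <
   k. *)
pose k := 1 + `|a|.
have k0 : 0 < k by rewrite ltr_pwDl.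
have ak : a < k by rewrite (le_lt_trans (ler_norm _))// ltrDr.
have := key (- b / k).
have -> : (- b / k) ^+ 2 * a + (- b / k) * b = (a - k) * (b / k) ^+ 2.
  by field; rewrite gt_eqF.
rewrite nmulr_rge0 ?subr_lt0// => h.
have /eqP : (b / k) ^+ 2 = 0 by apply/eqP; rewrite eq_le h sqr_ge0.
by rewrite sqrf_eq0 mulf_eq0 invr_eq0 (gt_eqF k0) orbF => /eqP.
Qed.

Lemma reflection_orthogonal (i : 'I_n) :
  orthogonal_mx (1%:M - 2 *: delta_mx i i : 'M[R]_n).
Proof.
rewrite /orthogonal_mx.
have D : delta_mx i i *m delta_mx i i = delta_mx i i :> 'M[R]_n.
  by rewrite mul_delta_mx.
have T : (delta_mx i i)^T = delta_mx i i :> 'M[R]_n by rewrite trmx_delta.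
move: (delta_mx i i) D T => D DD DT.
have -> : (1%:M - 2 *: D)^T = 1%:M - 2 *: D 
  by rewrite -{2}DT; apply/matrixP => k l; rewrite !mxE eq_sym.
rewrite mulmxBl !mulmxBr !mul1mx mulmx1 -!scalemxAl -!scalemxAr DD.
by apply/matrixP => k l; rewrite !mxE; ring.
Qed.

Lemma orthogonal_row_sqr U i : orthogonal_mx U -> \sum_j U i j ^+ 2 = 1.
Proof.
move=> /matrixP/(_ i i); rewrite !mxE eqxx => h; rewrite -[RHS]h.
by apply: eq_bigr => j _; rewrite mxE.
Qed.

Lemma orthogonal_le1 U i j : orthogonal_mx U -> `|U i j| <= 1.
Proof.
move=> /(orthogonal_row_sqr i) => h.
rewrite -(@ler_pXn2r _ 2)// ?nnegrE// expr1n -h real_normK ?num_real//.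
by rewrite (bigD1 j)//= lerDl sumr_ge0// => k _; exact: sqr_ge0.
Qed.

(** A pair of matrices is flattened into one row vector, the form in which the extreme value theorem
    is applied below. Entries are bounded by 1, and orthogonality is a closed condition entry by
    entry. *)
Lemma compact_orthogonal_pairs :
  compact [set w : 'rV[R]_(n * n + n * n) |
     orthogonal_mx (vec_mx (lsubmx w) : 'M[R]_n) /\
     orthogonal_mx (vec_mx (rsubmx w) : 'M[R]_n)].
Proof.
apply: bounded_closed_compact.
  exists 1; split => // x x1 w [wl wr]; apply: le_trans (ltW x1).
  rewrite /Num.norm /= mx_normrE; apply/bigmax_leP; split => //= -[i j] _ /=.
  rewrite (ord1 i) {i} -(hsubmxK w).
  case: (splitP j) => k jk.
    have -> : j = lshift _ k by apply/val_inj.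
    rewrite row_mxEl; case/mxvec_indexP: k jk => a b _.
    by have := orthogonal_le1 a b wl; rewrite mxE.
  have -> : j = rshift _ k by apply/val_inj.
  rewrite row_mxEr; case/mxvec_indexP: k jk => a b _.
  by have := orthogonal_le1 a b wr; rewrite mxE.
have cl (f : 'rV[R]_(n * n + n * n) -> 'M[R]_n) :
    (forall i j, continuous (fun w => f w i j)) ->
    closed [set w | orthogonal_mx (f w)].
  move=> cf.
  have -> : [set w | orthogonal_mx (f w)] = \bigcap_(i in setT) \bigcap_(j in setT)
    ((fun w => (f w *m (f w)^T) i j) @^-1` [set (1%:M : 'M[R]_n) i j]).
    apply/seteqP; split => w /=; first by move=> h i _ j _ /=; rewrite h.
    by move=> h; apply/matrixP => i j; exact: h.
  apply: closed_bigI => i _; apply: closed_bigI => j _.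
  apply: preimage_closed; last exact: closed_eq.
  move=> x _; move: x.
  apply: continuous_mulmx => // k l; under eq_fun do rewrite mxE.
  exact: cf.
apply: closedI; apply: cl => i j;
  under eq_fun do rewrite !mxE; exact: coord_continuous.
Qed.
End orthogonal_matrices.

(** * Existence of singular value decompositions *)

Section svd.
Context {R : realType} {n : nat}.
Implicit Types A B H U V Q : 'M[R]_n.

(* Maximize [\sum_i c_i (U^T A V)_ii] over orthogonal pairs, for pairwise
   distinct positive weights [c_i]: stationarity under plane rotations on
   either side makes [U^T A V] diagonal, and sign changes make it nonnegative. *)
Lemma svd_exists A : exists U s V, is_svd A U s V.
Proof.
(* The weights n, n - 1, ..., 1. With equal weights, stationarity would only make [M] symmetric. *)
pose c : 'rV[R]_n := \row_i (n - i)%:R.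
have c_gt0 i : 0 < c 0 i by rewrite mxE ltr0n subn_gt0.
have c_inj i j : i != j -> c 0 i != c 0 j.
  apply: contra; rewrite !mxE eqr_nat => /eqP h; apply/eqP/val_inj => /=.
  by have := ltn_ord i; have := ltn_ord j; lia.
pose f (w : 'rV[R]_(n * n + n * n)) :=
  \tr (diag_mx c *m ((vec_mx (lsubmx w))^T *m A *m vec_mx (rsubmx w))).
have cf : continuous f.
  rewrite /f /mxtrace; apply: continuous_big => [|i _ w].
    exact: add_continuous.
  move: w; apply: continuous_mulmx => k l; first exact: cst_continuous.
  move: k l; apply: continuous_mulmx => k l.
    apply: continuous_mulmx (k) (l) => {}k {}l; last exact: cst_continuous.
    by under eq_fun do rewrite !mxE; exact: coord_continuous.
  by under eq_fun do rewrite !mxE; exact: coord_continuous.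
have ne : [set w : 'rV[R]_(n * n + n * n) |
     orthogonal_mx (vec_mx (lsubmx w) : 'M[R]_n) /\
     orthogonal_mx (vec_mx (rsubmx w) : 'M[R]_n)] !=set0.
  exists (row_mx (mxvec 1%:M) (mxvec 1%:M)) => /=.
  by rewrite row_mxKl row_mxKr mxvecK; split; exact: orthogonal_mx1.
have [w] := EVT_max_rV ne compact_orthogonal_pairs (continuous_subspaceT cf).
rewrite inE /f /= => -[].
move: (vec_mx (lsubmx w)) (vec_mx (rsubmx w)) => U V {w ne cf} oU oV H.
have {f}H U' V' : orthogonal_mx U' -> orthogonal_mx V' ->
    \tr (diag_mx c *m (U'^T *m A *m V')) <= \tr (diag_mx c *m (U^T *m A *m V)).
  move=> oU' oV'; have := H (row_mx (mxvec U') (mxvec V')).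
  rewrite row_mxKl row_mxKr !mxvecK; apply.
  by rewrite inE /= row_mxKl row_mxKr !mxvecK; split.
pose M := U^T *m A *m V.
have HU Q : orthogonal_mx Q ->
    \tr (diag_mx c *m Q^T *m M) <= \tr (diag_mx c *m M).
  move=> oQ; have := H _ _ (orthogonal_mxM oU oQ) oV.
  by rewrite trmx_mul /M !mulmxA.
have HV Q : orthogonal_mx Q ->
    \tr (diag_mx c *m Q^T *m M^T) <= \tr (diag_mx c *m M^T).
  move=> oQ; have := H _ _ oU (orthogonal_mxM oV oQ).
  rewrite (mulmxA (U^T *m A)) -/M => h.
  rewrite -mxtrace_tr -[leRHS]mxtrace_tr !trmx_mul !trmxK tr_diag_mx.
  by rewrite mulmxA mxtrace_mulC [leRHS]mxtrace_mulC.
(* Rotations on the two sides give c_i M_ji = c_j M_ij and c_i M_ij = c_j M_ji; eliminating M_ji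
   leaves (c_i^2 - c_j^2) M_ij = 0. *)
have offdiag i j : i != j -> M i j = 0.
  move=> ij; have h1 := rotation_stationary HU ij.
  have := rotation_stationary HV ij; rewrite [M^T j i]mxE [M^T i j]mxE => h2.
  have : (c 0 i ^+ 2 - c 0 j ^+ 2) * M i j = 0.
    have -> : (c 0 i ^+ 2 - c 0 j ^+ 2) * M i j
      = c 0 i * (c 0 i * M i j) - c 0 j * (c 0 j * M i j) by ring.
    by rewrite -h1 {}h2; ring.
  move/eqP; rewrite mulf_eq0 subr_eq0 eqrXn2 ?ltW// (negbTE (c_inj _ _ ij)) /=.
  by move/eqP.
have diag_ge0 i : 0 <= M i i.
  have := HU _ (reflection_orthogonal i).
  have -> : (1%:M - 2 *: delta_mx i i)^T = 1%:M - 2 *: delta_mx i i :> 'M[R]_n.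
    by apply/matrixP => k l; rewrite !mxE eq_sym andbC.
  rewrite mulmxBr mulmx1 mulmxBl -scalemxAr -scalemxAl raddfB /= linearZ /=.
  rewrite gerBl pmulr_rge0//.
  rewrite /mxtrace (bigD1 i)//= big1 ?addr0.
    rewrite -mulmxA mul_diag_mx mxE [(_ *m M) i i]mxE (bigD1 i)//= big1 ?addr0.
      by rewrite [delta_mx _ _ _ _]mxE !eqxx mul1r pmulr_rge0.
    by move=> k /negbTE ki; rewrite [delta_mx _ _ _ _]mxE ki andbF mul0r.
  move=> k /negbTE ki; rewrite -mulmxA mul_diag_mx mxE [(_ *m M) k k]mxE.
  rewrite big1 ?mulr0// => l _.
  by rewrite [delta_mx _ _ _ _]mxE ki mul0r.
exists U, (\row_i M i i), V; split => // [i|]; first by rewrite mxE.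
have -> : diag_mx (\row_i M i i) = M.
  apply/matrixP => i j; rewrite mxE [(\row_k M k k) 0 i]mxE; have [->|ij] := eqVneq i j.
    by rewrite mulr1n.
  by rewrite mulr0n offdiag.
by rewrite /M !mulmxA oU mul1mx -mulmxA oV mulmx1.
Qed.
End svd.

(** * Gradients of the penalties *)

Lemma is_diff_eps {R : realType} (V W : normedModType R) (f : V -> W)
    (df : {linear V -> W}) (x : V) :
  continuous df ->
  (forall e : R, 0 < e ->
    \forall h \near (0 : V), `|f (x + h) - f x - df h| <= e * `|h|) ->
  is_diff x f df.
Proof.
move=> cdf h.
have key : f \o shift x = cst (f x) + df +o_ (0 : V) id.
  apply/eqaddoP => e /h; apply: filterS => y /=.
  rewrite [x + y]addrC -addrA -opprD; exact: id.
have dE := diff_unique cdf key.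
by apply: DiffDef => //; apply/diff_locallyP; rewrite dE.
Qed.

(** * The entrywise norm, the Frobenius inner product and its gradients *)

Section frobenius.
Context {R : realType}.

Lemma mx_coord_le (m n : nat) (A : 'M[R]_(m, n)) i j : `|A i j| <= `|A|.
Proof.
rewrite [leRHS]/Num.norm /= mx_normrE.
by apply/bigmax_geP; right; exists (i, j).
Qed.

Lemma mx_norm_leP (m n : nat) (A : 'M[R]_(m, n)) (c : R) :
  0 <= c -> (forall i j, `|A i j| <= c) -> `|A| <= c.
Proof.
move=> c0 h; rewrite [leLHS]/Num.norm /= mx_normrE.
by apply/bigmax_leP; split => // -[i j] _; exact: h.
Qed.

Lemma sum_ord_le (m : nat) (F : 'I_m -> R) (c : R) :
  (forall i, F i <= c) -> \sum_i F i <= m%:R * c.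
Proof.
by move=> Fc; rewrite -[m in leRHS]card_ord mulr_natl -sumr_const ler_sum//.
Qed.

(** The norm is the largest modulus of an entry, not the Frobenius norm, hence the dimension factor
    here and in the later estimates. *)
Lemma mx_norm_mulmx (m n p : nat) (A : 'M[R]_(m, n)) (B : 'M[R]_(n, p)) :
  `|A *m B| <= n%:R * (`|A| * `|B|).
Proof.
apply: mx_norm_leP => [|i j]; first by rewrite !mulr_ge0.
rewrite mxE (le_trans (ler_norm_sum _ _ _))//.
apply: sum_ord_le => k.
by rewrite normrM ler_pM// mx_coord_le.
Qed.

Lemma mx_norm_tr (m n : nat) (A : 'M[R]_(m, n)) : `|A^T| = `|A|.
Proof.
apply/eqP; rewrite eq_le; apply/andP; split.
  by apply: mx_norm_leP => // i j; rewrite mxE mx_coord_le.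
by apply: mx_norm_leP => // i j; have := mx_coord_le A^T j i; rewrite mxE.
Qed.

Context {n : nat}.
Implicit Types A B H U V Q G : 'M[R]_n.

Lemma frobDl A B H : frob (A + B) H = frob A H + frob B H.
Proof. by rewrite !frobE mulmxDl raddfD. Qed.

Lemma frobZl k A B : frob (k *: A) B = k * frob A B.
Proof. by rewrite !frobE -scalemxAl linearZ. Qed.

Lemma frobNl A B : frob (- A) B = - frob A B.
Proof. by rewrite -scaleN1r frobZl mulN1r. Qed.

Lemma frobDr H A B : frob H (A + B) = frob H A + frob H B.
Proof. by rewrite frobC frobDl !(frobC _ H). Qed.

Lemma frobZr k A B : frob A (k *: B) = k * frob A B.
Proof. by rewrite frobC frobZl frobC. Qed.

Lemma frobNr A B : frob A (- B) = - frob A B.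
Proof. by rewrite frobC frobNl frobC. Qed.

Definition frob_lin := (frobDl, frobDr, frobNl, frobNr, frobZl, frobZr).

Lemma frob_ge0 A : 0 <= frob A A.
Proof. by do 2![apply: sumr_ge0 => ? _]; rewrite -expr2 sqr_ge0. Qed.

Lemma frob_coord_sqr A i j : A i j ^+ 2 <= frob A A.
Proof.
rewrite /frob (bigD1 i)//= (bigD1 j)//= -expr2 -addrA lerDl addr_ge0//.
  by apply: sumr_ge0 => k _; rewrite -expr2 sqr_ge0.
by do 2![apply: sumr_ge0 => ? _]; rewrite -expr2 sqr_ge0.
Qed.

Lemma mx_norm_sqr_le A (c : R) :
  0 <= c -> (forall i j, A i j ^+ 2 <= c) -> `|A| ^+ 2 <= c.
Proof.
move=> c0 h; rewrite -(sqr_sqrtr c0) ler_pXn2r ?nnegrE ?sqrtr_ge0//.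
apply: mx_norm_leP; rewrite ?sqrtr_ge0// => i j.
by rewrite -sqrtr_sqr ler_sqrt.
Qed.

Lemma frob_norm_le A B : `|frob A B| <= (n * n)%:R * (`|A| * `|B|).
Proof.
rewrite (le_trans (ler_norm_sum _ _ _))//.
rewrite natrM -mulrA; apply: sum_ord_le => i.
rewrite (le_trans (ler_norm_sum _ _ _))//; apply: sum_ord_le => j.
by rewrite normrM ler_pM// mx_coord_le.
Qed.

Lemma frob_delta A i j : frob A (delta_mx i j) = A i j.
Proof.
rewrite /frob (bigD1 i)//= (bigD1 j)//= !mxE !eqxx mulr1.
rewrite big1 ?addr0 => [|k /negbTE kj]; last by rewrite mxE kj andbF mulr0.
rewrite big1 ?addr0// => k /negbTE ki; rewrite big1// => l _.
by rewrite mxE ki mulr0.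
Qed.

Lemma frob_inj A B : (forall H, frob A H = frob B H) -> A = B.
Proof. by move=> h; apply/matrixP => i j; rewrite -!frob_delta h. Qed.

Lemma frob_mulmxl A B H : frob (A *m B) H = frob B (A^T *m H).
Proof. by rewrite !frobE trmx_mul trmxK -mulmxA mxtrace_mulC -mulmxA. Qed.

Lemma frob_mulmxr A B H : frob (A *m B) H = frob A (H *m B^T).
Proof. by rewrite !frobE trmx_mul trmxK mulmxA. Qed.

Lemma frob_tr A B : frob A^T B^T = frob A B.
Proof. by rewrite !frobE trmxK -mxtrace_tr trmx_mul trmxK mxtrace_mulC. Qed.

Lemma frob_continuous G : continuous (frob G).
Proof.
apply: continuous_big => [|i _]; first exact: add_continuous.
apply: continuous_big => [|j _ A]; first exact: add_continuous.
by apply: continuousM; [exact: cst_continuous|exact: coord_continuous].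
Qed.

Lemma frob_is_linear G : linear (frob G).
Proof. by move=> k A B; rewrite !frob_lin. Qed.

HB.instance Definition _ G :=
  GRing.isLinear.Build R 'M[R]_n R *:%R (frob G) (frob_is_linear G).

(** Restricting to [|H| <= 1] allows remainders with a coefficient polynomial in [|H|]: on that ball
    the coefficient is bounded in terms of [A] alone. *)
Lemma is_gradient_quadratic (W : 'M[R]_n -> R) A G (c : R) :
  (forall H, `|H| <= 1 -> `|W (A + H) - W A - frob G H| <= c * `|H| ^+ 2) ->
  is_gradient W A G.
Proof.
move=> h.
apply: (@is_diff_eps _ _ _ _ (frob G)); first exact: frob_continuous.
move=> e e0; near=> H.
have H1 : `|H| <= 1 by near: H; exact: (@nbhs0_le _ 'M[R]_n _ ltr01).
rewrite (le_trans (h _ H1))// (@le_trans _ _ ((1 + `|c|) * `|H| ^+ 2))//.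
  by rewrite ler_wpM2r ?sqr_ge0// (le_trans (ler_norm _))// lerDr.
rewrite expr2 mulrA ler_wpM2r// -ler_pdivlMl ?ltr_pwDl//.
by near: H; apply: (@nbhs0_le _ 'M[R]_n); rewrite mulr_gt0// invr_gt0 ltr_pwDl.
Unshelve. all: by end_near. Qed.

(** Identifies the expressions coming from different singular value decompositions of one matrix,
    and a gradient obtained by choice with the explicit formula. *)
Lemma gradient_unique (W : 'M[R]_n -> R) A G H :
  is_gradient W A G -> is_gradient W A H -> G = H.
Proof.
move=> dG dH; apply: frob_inj => B.
by rewrite -(@diff_val _ _ _ _ _ _ _ dG) (@diff_val _ _ _ _ _ _ _ dH).
Qed.
End frobenius.

Lemma near_dist_le {R : realType} (V : normedModType R) (x : V) (e : R) :
  0 < e -> \forall y \near nbhs x, `|y - x| <= e.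
Proof.
move=> e0; apply/nbhs_ballP; exists e => //= y.
by rewrite -ball_normE /= distrC => /ltW.
Qed.

(** A local Lipschitz bound with polynomial constant. It yields continuity of [W], a bound on its
    gradients and a majorant of its difference quotients, and it makes sense where [W] is not
    differentiable. *)
Definition polynomial_growth {R : realType} {n : nat} (W : 'M[R]_n -> R)
    (c : R) (k : nat) := forall A H : 'M[R]_n,
  `|W (A + H) - W A| <= c * (1 + `|A| + `|H|) ^+ k * `|H|.

(** * Expansion and growth of the two penalties *)

Section penalties.
Context {R : realType} {n : nat}.
Implicit Types A B H U V Q G : 'M[R]_n.

Lemma frob_orthogonal Q : orthogonal_mx Q -> frob Q Q = n%:R.
Proof. by move=> oQ; rewrite frobE oQ mxtrace1. Qed.

Lemma dist2_On_le A Q : orthogonal_mx Q -> dist2_On A <= frob (Q - A) (Q - A).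
Proof.
move=> oQ; apply: ge_inf; last by exists Q.
by exists 0 => _ [B _ <-]; exact: frob_ge0.
Qed.

Lemma le_dist2_On A (c : R) :
  (forall Q, orthogonal_mx Q -> c <= frob (Q - A) (Q - A)) -> c <= dist2_On A.
Proof.
move=> h; apply: lb_le_inf; last by move=> _ [Q oQ <-]; exact: h.
by exists (frob (1%:M - A) (1%:M - A)); exists 1%:M => //; exact: orthogonal_mx1.
Qed.

(** The increment [H] changes the cost of each competitor Q by |H|_F^2 - 2 <Q - A, H>, and the
    entries of Q are at most 1 in modulus. The estimate is thus uniform in Q and survives the
    infimum, at singular [A] too. *)
Lemma dist2_On_addr A H :
  dist2_On (A + H) <=
  dist2_On A + (n * n)%:R * (2 * (1 + `|A|) * `|H| + `|H| ^+ 2).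
Proof.
rewrite -lerBlDr; apply: le_dist2_On => Q oQ; rewrite lerBlDr.
rewrite (le_trans (dist2_On_le _ oQ))// opprD addrA.
have -> : frob (Q - A - H) (Q - A - H) =
    frob (Q - A) (Q - A) + (frob H H - 2 * frob (Q - A) H).
  by rewrite !frob_lin !(frobC H); ring.
rewrite lerD2l mulrDr addrC lerD//; last first.
  by rewrite (le_trans (ler_norm _))// expr2 frob_norm_le.
rewrite -mulNr (le_trans (ler_norm _))// normrM normrN [`|2|]ger0_norm//.
rewrite -!mulrA [leRHS]mulrCA ler_pM2l// (le_trans (frob_norm_le _ _))//.
rewrite ler_wpM2l// ler_wpM2r// (le_trans (ler_normB _ _))// lerD2r.
by apply: mx_norm_leP => // i j; exact: orthogonal_le1.
Qed.

Lemma svd_unitmx_gt0 A U (s : 'rV[R]_n) V i :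
  A \in unitmx -> is_svd A U s V -> 0 < s 0 i.
Proof.
move=> uA [_ _ s_ge0 AE]; rewrite lt_def s_ge0 andbT.
apply: contraTneq uA => si0; rewrite AE unitmxE !det_mulmx det_diag.
by rewrite (bigD1 i)//= si0 mul0r mulr0 mul0r unitr0.
Qed.

Lemma frob_diag B (s : 'rV[R]_n) : frob B (diag_mx s) = \sum_i B i i * s 0 i.
Proof.
apply: eq_bigr => i _; rewrite (bigD1 i)//= big1 ?addr0 => [|j /negbTE ji].
  by rewrite mxE eqxx mulr1n.
by rewrite mxE eq_sym ji mulr0n mulr0.
Qed.

Lemma frob_conj B U D V : frob B (U *m D *m V^T) = frob (U^T *m B *m V) D.
Proof. by rewrite frobC -mulmxA frob_mulmxl frob_mulmxr trmxK frobC. Qed.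

(** In the frame of the decomposition only the diagonal of Q' = U^T Q V matters: the squared
    distance on the left is 2 sum_i (1 - Q'_ii), the pairing on the right is sum_i (1 - Q'_ii) s_i,
    and Q'_ii <= 1. The case c = 0 gives minimality of the polar factor, c > 0 the second-order
    expansion. *)
Lemma polar_coercive A U (s : 'rV[R]_n) V (c : R) Q :
  is_svd A U s V -> (forall i, c <= s 0 i) -> orthogonal_mx Q ->
  c * frob (U *m V^T - Q) (U *m V^T - Q) <= 2 * frob (U *m V^T - Q) A.
Proof.
move=> [oU oV _ AE] cs oQ; pose Q' := U^T *m Q *m V.
have oQ' : orthogonal_mx Q'.
  apply: orthogonal_mxM => //; apply: orthogonal_mxM => //.
  exact: orthogonal_mx_tr.
have E : frob (U *m V^T - Q) A = \sum_i (1 - Q' i i) * s 0 i.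
  rewrite AE frob_conj mulmxBr mulmxBl.
  rewrite !mulmxA ((orthogonal_mxP _).1 oU) mul1mx.
  rewrite ((orthogonal_mxP _).1 oV) frob_diag -/Q'.
  by apply: eq_bigr => i _; rewrite 3!mxE eqxx.
have -> : frob (U *m V^T - Q) (U *m V^T - Q) = 2 * \sum_i (1 - Q' i i).
  have trQ' : frob Q (U *m V^T) = \sum_i Q' i i.
    rewrite -[U in U *m _]mulmx1 frob_conj -/Q' -diag_const_mx frob_diag.
    by apply: eq_bigr => i _; rewrite [const_mx _ _ _]mxE mulr1.
  rewrite !frob_lin (frobC _ Q) trQ' !frob_orthogonal//; last first.
    by apply: orthogonal_mxM => //; exact: orthogonal_mx_tr.
  by rewrite sumrB sumr_const card_ord; ring.
rewrite E mulrCA ler_pM2l// mulr_sumr ler_sum// => i _.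
rewrite mulrC ler_wpM2l// subr_ge0 (le_trans (ler_norm _))//.
exact: orthogonal_le1.
Qed.

Lemma dist2_On_svd A U (s : 'rV[R]_n) V :
  is_svd A U s V -> dist2_On A = frob (U *m V^T - A) (U *m V^T - A).
Proof.
move=> svdA; have [oU oV s0 _] := svdA.
have oUV : orthogonal_mx (U *m V^T).
  by apply: orthogonal_mxM => //; exact: orthogonal_mx_tr.
apply/eqP; rewrite eq_le dist2_On_le//=; apply: le_dist2_On => Q oQ.
have := polar_coercive svdA s0 oQ; rewrite mul0r.
rewrite !frob_lin !(frob_orthogonal oUV) (frob_orthogonal oQ).
rewrite !(frobC _ Q) !(frobC _ (U *m V^T)); lra.
Qed.

Lemma dist2_On_taylor A U (s : 'rV[R]_n) V (c : R) H :
  is_svd A U s V -> 0 < c -> (forall i, c <= s 0 i) ->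
  `|dist2_On (A + H) - dist2_On A - 2 * frob (A - U *m V^T) H|
  <= (1 + c^-1) * frob H H.
Proof.
move=> svdA c0 cs; have [oU oV s0 _] := svdA.
have oUV : orthogonal_mx (U *m V^T).
  by apply: orthogonal_mxM => //; exact: orthogonal_mx_tr.
have cV : 0 <= c^-1 * frob H H by rewrite mulr_ge0 ?frob_ge0// invr_ge0 ltW.
have hH := frob_ge0 H.
have up := dist2_On_le (A + H) oUV.
have {}up : dist2_On (A + H) <= dist2_On A + 2 * frob (A - U *m V^T) H + frob H H.
  move: up; rewrite (dist2_On_svd svdA) !frob_lin !(frobC _ (U *m V^T)) !(frobC H).
  lra.
have lo : dist2_On A + 2 * frob (A - U *m V^T) H - c^-1 * frob H H
    <= dist2_On (A + H).
  apply: le_dist2_On => Q oQ; have := polar_coercive svdA cs oQ.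
  set D := U *m V^T - Q.
  (* Completing the square: coercivity absorbs the cross term 2 <D, H> produced by a competitor at
     distance D from the polar factor, at the price c^-1 |H|_F^2. *)
  have : 0 <= c^-1 * frob (c *: D + H) (c *: D + H).
    by rewrite mulr_ge0 ?frob_ge0// invr_ge0 ltW.
  have -> : c^-1 * frob (c *: D + H) (c *: D + H)
      = c * frob D D + 2 * frob D H + c^-1 * frob H H.
    by rewrite !frob_lin !(frobC H); field; rewrite gt_eqF.
  rewrite (dist2_On_svd svdA) {2 3}/D !frob_lin !(frobC _ (U *m V^T)) !(frobC H).
  rewrite !(frobC A Q) !(frob_orthogonal oUV) (frob_orthogonal oQ); lra.
rewrite ler_norml mulrDl mul1r; apply/andP; split; lra.
Qed.

Lemma W1_gradient (eps : R) A U s V : A \in unitmx -> is_svd A U s V ->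
  is_gradient (W1 eps) A (eps ^- 2 *: (U *m (diag_mx s - 1%:M) *m V^T)).
Proof.
move=> uA svdA; have [_ _ _ AE] := svdA.
have s_gt0 i := svd_unitmx_gt0 i uA svdA.
(* A positive lower bound for all singular values, since c^-1 exceeds each s_i^-1; the summand 1
   covers n = 0. *)
pose c := (1 + \sum_i (s 0 i)^-1)^-1.
have S0 : 0 <= \sum_i (s 0 i)^-1 by apply: sumr_ge0 => i _; rewrite invr_ge0 ltW.
have c_gt0 : 0 < c by rewrite invr_gt0 ltr_pwDl.
have cs i : c <= s 0 i.
  rewrite -[leRHS]invrK lef_pV2 ?posrE ?invr_gt0 ?ltr_pwDl//.
  rewrite (bigD1 i)//= addrCA lerDl addr_ge0// sumr_ge0// => j _.
  by rewrite invr_ge0 ltW.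
rewrite mulmxBr mulmx1 mulmxBl -AE.
pose k := (2 * eps ^+ 2)^-1.
have k_ge0 : 0 <= k by rewrite invr_ge0 mulr_ge0// sqr_ge0.
apply: (@is_gradient_quadratic _ _ _ _ _ (k * (1 + c^-1) * (n * n)%:R)) => H _.
have -> : W1 eps (A + H) - W1 eps A - frob (eps ^- 2 *: (A - U *m V^T)) H =
    k * (dist2_On (A + H) - dist2_On A - 2 * frob (A - U *m V^T) H).
  rewrite /W1 -/k frobZl; have -> : eps ^- 2 = 2 * k; last by ring.
  by rewrite /k [(_ * eps ^+ 2)^-1]invfM mulrA divff ?mul1r.
rewrite normrM ger0_norm// -!mulrA ler_wpM2l//.
rewrite (le_trans (dist2_On_taylor H svdA c_gt0 cs))// ler_wpM2l//.
  by rewrite addr_ge0// invr_ge0 ltW.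
by rewrite (le_trans (ler_norm _))// expr2 frob_norm_le.
Qed.

Lemma W1_growth (eps : R) : exists c, polynomial_growth (@W1 R n eps) c 1.
Proof.
pose k := (2 * eps ^+ 2)^-1.
have k_ge0 : 0 <= k by rewrite invr_ge0 mulr_ge0// sqr_ge0.
(* The one-sided estimate is used twice, from [A] to [A + H] and back by [- H]. The factor 3 comes
   from 2 (1 + |A + H|) |H| + |H|^2 <= 3 (1 + |A| + |H|) |H|. *)
exists (k * ((n * n)%:R * 3)) => A H; rewrite expr1.
rewrite /W1 -/k -mulrBr normrM ger0_norm// -!mulrA ler_wpM2l//.
have h1 := dist2_On_addr A H; have := dist2_On_addr (A + H) (- H).
rewrite addrK normrN => h2.
have N : (0 : R) <= (n * n)%:R by [].
have aH : `|A + H| <= `|A| + `|H| by exact: ler_normD.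
have h3 : (n * n)%:R * (2 * (1 + `|A + H|) * `|H| + `|H| ^+ 2) <=
    (n * n)%:R * (3 * ((1 + `|A| + `|H|) * `|H|)).
  rewrite ler_wpM2l//.
  have -> : 3 * ((1 + `|A| + `|H|) * `|H|) =
    2 * (1 + (`|A| + `|H|)) * `|H| + `|H| ^+ 2 + (1 + `|A|) * `|H| by ring.
  rewrite -addrA lerD//; first by rewrite ler_wpM2r// ler_pM2l// lerD2l.
  by rewrite lerDl mulr_ge0// addr_ge0.
have h4 : (n * n)%:R * (2 * (1 + `|A|) * `|H| + `|H| ^+ 2) <=
    (n * n)%:R * (3 * ((1 + `|A| + `|H|) * `|H|)).
  rewrite ler_wpM2l//.
  have -> : 3 * ((1 + `|A| + `|H|) * `|H|) =
    2 * (1 + `|A|) * `|H| + `|H| ^+ 2 + ((1 + `|A|) * `|H| + 2 * `|H| ^+ 2) by ring.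
  by rewrite lerDl addr_ge0// mulr_ge0// addr_ge0.
rewrite ler_norml; apply/andP; split; lra.
Qed.

Definition W2_grad (eps : R) A : 'M[R]_n := eps ^- 2 *: (A *m (A^T *m A - 1%:M)).

Lemma W2_grad_svd (eps : R) A U s V : is_svd A U s V ->
  W2_grad eps A =
  eps ^- 2 *: (U *m (diag_mx s *m diag_mx s - 1%:M) *m diag_mx s *m V^T).
Proof.
move=> [oU oV _ AE]; congr (_ *: _).
rewrite mulmxBr mulmx1 mulmxBr mulmx1 !mulmxBl -AE; congr (_ - _).
rewrite AE !trmx_mul trmxK tr_diag_mx !mulmxA.
rewrite -[_ *m V^T *m V]mulmxA ((orthogonal_mxP _).1 oV) mulmx1.
by rewrite -[_ *m U^T *m U]mulmxA ((orthogonal_mxP _).1 oU) mulmx1.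
Qed.

Lemma W2_taylor (eps : R) : exists c, forall A H,
  `|W2 eps (A + H) - W2 eps A - frob (W2_grad eps A) H|
  <= c * (1 + `|A| + `|H|) ^+ 2 * `|H| ^+ 2.
Proof.
pose k := (4 * eps ^+ 2)^-1.
have k_ge0 : 0 <= k by rewrite invr_ge0 mulr_ge0// sqr_ge0.
pose m : R := n%:R.
(* The two summands bound 2 <Y, L> and |K + L|_F^2 below, from |Y| <= (m + 1)(1 + |A| + |H|)^2, |L|
   <= m |H|^2 and |K + L| <= 2 m (1 + |A| + |H|) |H|; each Frobenius product costs a factor m^2. *)
exists (k * (2 * (m * m) * (m * (m + 1)) + (m * m) * (4 * m ^+ 2))) => A H.
(* Replacing A by A + H turns [Y] into [Y + (K + L)], with [K] linear and [L] quadratic in [H]. As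
   [Y] is symmetric, 2 <Y, K> = 4 <A Y, H>, which is the gradient term; the other terms are
   quadratic in [H] or higher. *)
pose Y := A^T *m A - 1%:M; pose K := A^T *m H + H^T *m A; pose L := H^T *m H.
have E : W2 eps (A + H) - W2 eps A - frob (W2_grad eps A) H =
    k * (2 * frob Y L + frob (K + L) (K + L)).
  have -> : W2 eps (A + H) = k * frob (Y + (K + L)) (Y + (K + L)).
    have trD : (A + H)^T = A^T + H^T by apply/matrixP => i j; rewrite !mxE.
    rewrite /W2 -/k; congr (_ * frob _ _); rewrite /Y /K /L trD;
      rewrite mulmxDl !mulmxDr;
      move: (_ *m _) (_ *m _) (_ *m _) (_ *m _) => a b c d;
      apply/matrixP => i j; rewrite !mxE; ring.
  have -> : W2 eps A = k * frob Y Y by [].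
  have -> : frob (W2_grad eps A) H = 2 * k * frob Y K.
    rewrite /W2_grad frobZl frob_mulmxl -/Y frobDr.
    have -> : frob Y (H^T *m A) = frob Y (A^T *m H).
      by rewrite -frob_tr /Y linearB /= !trmx_mul trmx1 !trmxK.
    have -> : eps ^- 2 = 4 * k.
      by rewrite /k [(_ * eps ^+ 2)^-1]invfM mulrA divff ?mul1r.
    by ring.
  move: Y K L => Y K L.
  by rewrite !frob_lin !(frobC _ Y) !(frobC L K); ring.
rewrite E normrM ger0_norm// -!(mulrA k) ler_wpM2l//.
set a := `|A|; set h := `|H|.
have a0 : 0 <= a := normr_ge0 A.
have h0 : 0 <= h := normr_ge0 H.
have m0 : 0 <= m := ler0n _ n.
have nL : `|L| <= m * h ^+ 2.
  by rewrite (le_trans (mx_norm_mulmx _ _))// mx_norm_tr -expr2.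
have nK : `|K| <= 2 * (m * (a * h)).
  rewrite (le_trans (ler_normD _ _))// mulrDl mul1r lerD//.
    by rewrite (le_trans (mx_norm_mulmx _ _))// mx_norm_tr.
  by rewrite (le_trans (mx_norm_mulmx _ _))// mx_norm_tr [`|H| * _]mulrC.
have nY : `|Y| <= m * a ^+ 2 + 1.
  rewrite (le_trans (ler_normB _ _))// lerD//.
    by rewrite (le_trans (mx_norm_mulmx _ _))// mx_norm_tr -expr2.
  by apply: mx_norm_leP => // i j; rewrite mxE; case: (i == j);
    rewrite ?normr1 ?normr0.
have b1 : `|2 * frob Y L| <=
    2 * (m * m) * (m * (m + 1)) * ((1 + a + h) ^+ 2 * h ^+ 2).
  have -> : 2 * (m * m) * (m * (m + 1)) * ((1 + a + h) ^+ 2 * h ^+ 2) =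
    2 * (m * m * ((m + 1) * (1 + a + h) ^+ 2 * (m * h ^+ 2))) by ring.
  rewrite normrM [`|2|]ger0_norm// ler_pM2l// (le_trans (frob_norm_le _ _))//.
  rewrite natrM -/m ler_wpM2l ?mulr_ge0// ler_pM// (le_trans nY)//.
  have -> : (m + 1) * (1 + a + h) ^+ 2 =
    m * a ^+ 2 + 1 + (m * (1 + h) * (1 + h + 2 * a) + (a + h) * (a + h + 2)) by ring.
  by rewrite lerDl addr_ge0// mulr_ge0// ?mulr_ge0// !addr_ge0// mulr_ge0.
have b2 : `|frob (K + L) (K + L)| <=
    (m * m) * (4 * m ^+ 2) * ((1 + a + h) ^+ 2 * h ^+ 2).
  rewrite (le_trans (frob_norm_le _ _))// natrM -/m.
  rewrite -[leRHS]mulrA ler_wpM2l ?mulr_ge0//.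
  have -> : 4 * m ^+ 2 * ((1 + a + h) ^+ 2 * h ^+ 2) =
    (2 * m * (1 + a + h) * h) ^+ 2 by ring.
  rewrite -expr2 ler_pXn2r ?nnegrE// ?mulr_ge0// ?addr_ge0//.
  rewrite (le_trans (ler_normD _ _))// (le_trans (lerD nK nL))//.
  have -> : 2 * m * (1 + a + h) * h = 2 * (m * (a * h)) + m * h ^+ 2
     + (m * h ^+ 2 + 2 * (m * h)) by ring.
  by rewrite lerDl addr_ge0// ?mulr_ge0// sqr_ge0.
move: b1 b2.
move: (2 * (m * m) * _) (m * m * _) (_ ^+ 2) (h ^+ 2) => x y q r b1 b2.
by rewrite -mulrA [leRHS]mulrDl (le_trans (ler_normD _ _))//; exact: lerD.
Qed.

(** The exponent is the degree of the gradient; in the Taylor remainder one factor |H| is traded for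
    1 + |A| + |H|. *)
Lemma W2_growth (eps : R) : exists c, polynomial_growth (@W2 R n eps) c 3.
Proof.
have [c hc] := W2_taylor eps.
pose m : R := n%:R; have m0 : 0 <= m := ler0n _ n.
have e0 : 0 <= eps ^- 2 by rewrite invr_ge0 sqr_ge0.
exists (`|c| + (n * n)%:R * (eps ^- 2 * (m * (m + 1)))) => A H.
have -> : W2 eps (A + H) - W2 eps A =
  W2 eps (A + H) - W2 eps A - frob (W2_grad eps A) H + frob (W2_grad eps A) H.
  by rewrite subrK.
rewrite (le_trans (ler_normD _ _))// -mulrA [leRHS]mulrDl lerD//.
  rewrite (le_trans (hc _ _))//.
  have x0 : 0 <= 1 + `|A| + `|H| by rewrite !addr_ge0.
  move: (1 + `|A| + `|H|) x0 (lerDr (`|H|) (1 + `|A|)) => x x0.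
  rewrite addr_ge0// => Hx.
  rewrite (@le_trans _ _ (`|c| * x ^+ 2 * `|H| ^+ 2))//.
    by rewrite !ler_wpM2r ?exprn_ge0// ler_norm.
  rewrite -(mulrA `|c|) ler_wpM2l// [x ^+ 3]exprSr.
  rewrite -[leRHS]mulrA ler_wpM2l ?exprn_ge0//.
  by rewrite expr2 ler_wpM2r.
rewrite (le_trans (frob_norm_le _ _))// -[leRHS]mulrA ler_wpM2l//.
rewrite [leRHS]mulrA ler_wpM2r//.
rewrite /W2_grad normrZ ger0_norm// -[leRHS]mulrA ler_wpM2l//.
rewrite (le_trans (mx_norm_mulmx _ _))// -[leRHS]mulrA ler_wpM2l//.
set a := `|A|; set h := `|H|.
have a0 : 0 <= a := normr_ge0 A.
have h0 : 0 <= h := normr_ge0 H.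
apply: (@le_trans _ _ (a * (m * a ^+ 2 + 1))).
  rewrite ler_wpM2l// (le_trans (ler_normB _ _))// lerD//.
    by rewrite (le_trans (mx_norm_mulmx _ _))// mx_norm_tr -expr2.
  by apply: mx_norm_leP => // i j; rewrite mxE; case: (i == j);
    rewrite ?normr1 ?normr0.
apply: (@le_trans _ _ ((1 + a + h) * ((m + 1) * (1 + a + h) ^+ 2))).
  apply: ler_pM => //; first by rewrite addr_ge0// mulr_ge0// sqr_ge0.
    by rewrite addrAC lerDr addr_ge0.
  have -> : (m + 1) * (1 + a + h) ^+ 2 =
    m * a ^+ 2 + 1 + (m * (1 + h) * (1 + h + 2 * a) + (a + h) * (a + h + 2)) by ring.
  by rewrite lerDl addr_ge0// mulr_ge0// ?mulr_ge0// !addr_ge0// mulr_ge0.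
by rewrite mulrCA -exprS.
Qed.

Lemma W2_gradient (eps : R) A : is_gradient (W2 eps) A (W2_grad eps A).
Proof.
have [c hc] := W2_taylor eps.
apply: (@is_gradient_quadratic _ _ _ _ _ (`|c| * (2 + `|A|) ^+ 2)) => H H1.
rewrite (le_trans (hc _ _))// ler_wpM2r ?sqr_ge0//.
apply: (@le_trans _ _ (`|c| * (1 + `|A| + `|H|) ^+ 2)).
  by rewrite ler_wpM2r ?sqr_ge0// ler_norm.
rewrite ler_wpM2l// ler_pXn2r// ?nnegrE ?addr_ge0//.
by have := H1; lra.
Qed.

Lemma W2_ge0 (eps : R) A : 0 <= W2 eps A.
Proof.
by rewrite /W2 mulr_ge0 ?frob_ge0// invr_ge0 mulr_ge0// sqr_ge0.
Qed.

Lemma polynomial_growth_continuous (W : 'M[R]_n -> R) (c : R) (k : nat) :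
  polynomial_growth W c k -> continuous W.
Proof.
move=> h A; apply/(@cvgrPdist_le _ _ _ (nbhs A)) => e e0.
pose b := 1 + `|c| * (2 + `|A|) ^+ k.
have b0 : 0 < b by rewrite ltr_pwDl// mulr_ge0// exprn_ge0// addr_ge0.
have be : 0 < b^-1 * e by rewrite mulr_gt0// invr_gt0.
near=> B.
have AB : `|B - A| <= 1.
  by near: B; exact: (@near_dist_le _ 'M[R]_n _ _ ltr01).
have AB' : `|B - A| <= b^-1 * e.
  by near: B; exact: (@near_dist_le _ 'M[R]_n _ _ be).
rewrite distrC; have := h A (B - A); rewrite (addrC A) subrK => /le_trans; apply.
apply: (@le_trans _ _ (b * `|B - A|)); last by rewrite -ler_pdivlMl.
rewrite ler_wpM2r// /b (@le_trans _ _ (`|c| * (1 + `|A| + `|B - A|) ^+ k))//.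
  by rewrite ler_wpM2r ?ler_norm// exprn_ge0// !addr_ge0.
rewrite (@le_trans _ _ (`|c| * (2 + `|A|) ^+ k)) ?lerDr// ler_wpM2l//.
case: (k) => // k'.
by rewrite ler_pXn2r// ?nnegrE ?addr_ge0//; move: AB; lra.
Unshelve. all: by end_near. Qed.
End penalties.

(** * Differential calculus in R^d *)

Lemma near_eq_continuous (T U : topologicalType) (f g : T -> U) (x : T) :
  {near x, f =1 g} -> {for x, continuous f} -> {for x, continuous g}.
Proof.
move=> fg cf; have fgx := nbhs_singleton fg.
rewrite /prop_for /continuous_at -fgx; apply: cvg_trans cf.
by apply: near_eq_cvg; apply: filterS fg => y ->.
Qed.

Section multivariate_calculus.
Context {R : realType}.

Lemma is_derive_line (V : normedModType R) (f : V -> R) (z v : V) (t : R) :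
  derivable f (z + t *: v) v ->
  is_derive t 1 (fun s => f (z + s *: v)) ('D_v f (z + t *: v)).
Proof.
move=> df.
have E : (fun h : R => h^-1 *: (((fun s => f (z + s *: v)) \o shift t) (h *: 1)
      - f (z + t *: v))) =
    (fun h => h^-1 *: ((f \o shift (z + t *: v)) (h *: v) - f (z + t *: v))).
  apply/funext => h /=; congr (_ *: (f _ - _)).
  by rewrite [h%:A]mulr1 scalerDl addrCA.
by apply: DeriveDef; rewrite /derivable /derive E.
Qed.

(** The step [a] may have either sign, as coordinate increments do, and only derivatives in the
    direction [v] are required. *)
Lemma directional_mean_value (V : normedModType R) (f : V -> R) (z v : V) (a : R) :
  (forall t : R, `|t| <= `|a| -> derivable f (z + t *: v) v) ->
  exists t : R, `|t| <= `|a| /\ f (z + a *: v) - f z = a * 'D_v f (z + t *: v).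
Proof.
move=> df; pose g s := f (z + s *: v).
have dg (t : R) : `|t| <= `|a| -> is_derive t 1 g ('D_v f (z + t *: v)).
  by move=> /df; exact: is_derive_line.
have cg (u w : R) : (forall t : R, t \in `[u, w]%R -> `|t| <= `|a|) ->
    {within `[u, w], continuous g}.
  move=> h; apply: derivable_within_continuous => t /h /dg gt.
  exact: (@ex_derive _ _ _ _ _ _ _ gt).
have g0 : g 0 = f z by rewrite /g scale0r addr0.
have [a0|a0] := leP 0 a.
  have sub (t : R) : t \in `[0, a]%R -> `|t| <= `|a|.
    by rewrite in_itv/= => /andP[t0 ta]; rewrite !ger0_norm.
  have dg' (t : R) : t \in `]0, a[%R -> is_derive t 1 g ('D_v f (z + t *: v)).
    by move=> h; apply: dg; apply: sub; move: h; rewrite !in_itv/= => /andP[/ltW-> /ltW->].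
  have [t /sub ta] := MVT_segment a0 dg' (cg _ _ sub).
  by rewrite g0 subr0 => h; exists t; split => //; rewrite mulrC -h.
have sub (t : R) : t \in `[a, 0]%R -> `|t| <= `|a|.
  by rewrite in_itv/= => /andP[ta t0]; rewrite !ler0_norm ?lerN2// ltW.
have dg' (t : R) : t \in `]a, 0[%R -> is_derive t 1 g ('D_v f (z + t *: v)).
  by move=> h; apply: dg; apply: sub; move: h; rewrite !in_itv/= => /andP[/ltW-> /ltW->].
have [t /sub ta] := MVT_segment (ltW a0) dg' (cg _ _ sub).
rewrite g0 sub0r mulrN => h; exists t; split => //.
by rewrite -opprB h opprK mulrC.
Qed.

Context {d : nat}.
Implicit Types (x y : 'rV[R]_d) (f g : 'rV[R]_d -> R) (O : set 'rV[R]_d).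

Definition partial_lin f x (v : 'rV[R]_d) : R := \sum_k v 0 k * partial k f x.

Lemma partial_lin_is_linear f x : linear (partial_lin f x).
Proof.
move=> a u v; rewrite /partial_lin scaler_sumr -big_split /=.
by apply: eq_bigr => k _; rewrite !mxE mulrDl scalerAl.
Qed.

HB.instance Definition _ f x :=
  GRing.isLinear.Build R 'rV[R]_d R *:%R (partial_lin f x)
    (partial_lin_is_linear f x).

Lemma partial_lin_continuous f x : continuous (partial_lin f x).
Proof.
apply: continuous_big => [|k _ v]; first exact: add_continuous.
by apply: (@continuousM R 'rV[R]_d (fun v => v 0 k) (fun=> partial k f x));
  [exact: coord_continuous|exact: cst_continuous].
Qed.

(** One moves from x to x + h a coordinate at a time and applies the mean value theorem on each
    segment. In the maximum norm all these segments stay in the ball around x on which the partial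
    derivatives are controlled. *)
Lemma C1_is_diff f x :
  (forall k, \forall y \near nbhs x, derivable f y (delta_mx 0 k)) ->
  (forall k, {for x, continuous (partial k f)}) ->
  is_diff x f (partial_lin f x).
Proof.
move=> df cf; apply: is_diff_eps => [|e e0]; first exact: partial_lin_continuous.
(* There are d steps; dividing by d + 1 also covers d = 0. *)
pose e' := (d.+1)%:R^-1 * e.
have e'0 : 0 < e' by rewrite mulr_gt0// invr_gt0.
have : \forall y \near nbhs x, forall k, derivable f y (delta_mx 0 k) /\
    `|partial k f y - partial k f x| <= e'.
  apply: filter_forall => k.
  have ck : \forall y \near nbhs x, `|partial k f y - partial k f x| <= e'.
    exact: (cvgr_distC_le _ _ (cf k) _ e'0).
  by apply: filterS2 (df k) ck.
move=> /nbhs_ballP[r /= r0 hr].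
apply/nbhs_ballP; exists r => //= h.
rewrite -ball_normE /= sub0r normrN => hlt.
(* The j-th vertex of the path: the first j coordinates have already moved to those of x + h. *)
pose z j : 'rV[R]_d := x + \row_k (if (k < j)%N then h 0 k else 0).
have z0 : z 0%N = x by rewrite /z; apply/rowP => k; rewrite !mxE addr0.
have zd : z d = x + h by rewrite /z; apply/rowP => k; rewrite !mxE ltn_ord.
have zS (k : 'I_d) : z k.+1 = z k + h 0 k *: delta_mx 0 k.
  apply/rowP => l; rewrite !mxE eqxx /= ltnS leq_eqVlt (inj_eq val_inj).
  have [->|kl] := eqVneq l k; first by rewrite ltnn mulr1 addr0.
  by rewrite mulr0 addr0.
have near_x (k : 'I_d) (t : R) : `|t| <= `|h 0 k| -> ball x r (z k + t *: delta_mx 0 k).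
  move=> th; rewrite -ball_normE /= /z opprD opprD !addrA subrr add0r -opprD normrN.
  apply: le_lt_trans hlt; apply: mx_norm_leP => // i l; rewrite ord1 !mxE eqxx /=.
  have [->|kl] := eqVneq l k.
    by rewrite ltnn add0r mulr1 (le_trans th)// mx_coord_le.
  rewrite mulr0 addr0; case: ifP => _; rewrite ?normr0//.
  exact: mx_coord_le.
have step (k : 'I_d) : `|f (z k.+1) - f (z k) - h 0 k * partial k f x| <= e' * `|h|.
  have dk (t : R) : `|t| <= `|h 0 k| ->
      derivable f (z k + t *: delta_mx 0 k) (delta_mx 0 k).
    by move=> th; have [] := hr _ (near_x _ _ th) k.
  have [t [th fE]] := directional_mean_value dk.
  rewrite zS fE -mulrBr normrM mulrC ler_pM ?mx_coord_le//.
  by have [_] := hr _ (near_x _ _ th) k.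
have -> : f (x + h) - f x = \sum_(k < d) (f (z k.+1) - f (z k)).
  rewrite -zd -[in f x]z0 -(big_mkord xpredT (fun k => f (z k.+1) - f (z k))).
  by rewrite telescope_sumr.
rewrite /partial_lin -sumrB (le_trans (ler_norm_sum _ _ _))//.
rewrite (le_trans (sum_ord_le step))// mulrA ler_wpM2r// mulrA.
by rewrite -[leRHS]mul1r ler_pM2r// ler_pdivrMr// mul1r ler_nat.
Qed.

(** The rules for sums, products and inverses compute a partial derivative only on [O]. This lemma
    transfers regularity from the computed formula to the derivative itself; openness turns equality
    on [O] into equality near each point. *)
Lemma Ck_on_ext (m : nat) O f g : open O ->
  (forall x, O x -> f x = g x) -> Ck_on m O f -> Ck_on m O g.
Proof.
move=> oO; have nfg f' g' : (forall x, O x -> f' x = g' x) ->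
    forall x, O x -> {near x, f' =1 g'}.
  by move=> fg x Ox; apply: filterS (open_nbhs_nbhs (conj oO Ox)) => y /fg.
elim: m f g => [|m IH] f g fg [cf df].
  by split => // x Ox; exact: near_eq_continuous (nfg _ _ fg x Ox) (cf x Ox).
split=> [x Ox|k]; first exact: near_eq_continuous (nfg _ _ fg x Ox) (cf x Ox).
have [dfk Cfk] := df k; split => [x Ox|].
  exact: near_eq_derivable (nfg _ _ fg x Ox) (dfk x Ox).
by apply: IH Cfk => x Ox; exact: near_eq_derive (nfg _ _ fg x Ox).
Qed.

Lemma Ck_onS (m : nat) O f : Ck_on m.+1 O f -> Ck_on m O f.
Proof.
elim: m f => [|m IH] f [cf df]; split => // k.
by have [dfk /IH] := df k.
Qed.

Lemma Ck_on_cst (m : nat) O (c : R) : Ck_on m O (fun=> c).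
Proof.
elim: m c => [|m IH] c; first by split => // x _; exact: cst_continuous.
split=> [x _|k]; first exact: cst_continuous.
split=> [x _|]; first exact: derivable_cst.
have -> : partial k (fun=> c) = (fun=> 0) :> ('rV[R]_d -> R).
  by apply/funext => x; rewrite /partial derive_cst.
exact: IH.
Qed.

Lemma Ck_onD (m : nat) O f g : open O ->
  Ck_on m O f -> Ck_on m O g -> Ck_on m O (fun x => f x + g x).
Proof.
move=> oO; elim: m f g => [|m IH] f g [cf df] [cg dg].
  by split => // x Ox; apply: continuousD; [exact: cf|exact: cg].
split=> [x Ox|k]; first by apply: continuousD; [exact: cf|exact: cg].
have [dfk Cfk] := df k; have [dgk Cgk] := dg k; split=> [x Ox|].
  by apply: derivableD; [exact: dfk|exact: dgk].
apply: Ck_on_ext (IH _ _ Cfk Cgk) => // x Ox.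
by rewrite /partial deriveD//; [exact: dfk|exact: dgk].
Qed.

Lemma Ck_onM (m : nat) O f g : open O ->
  Ck_on m O f -> Ck_on m O g -> Ck_on m O (fun x => f x * g x).
Proof.
move=> oO; elim: m f g => [|m IH] f g Cf Cg.
  have [cf _] := Cf; have [cg _] := Cg.
  by split => // x Ox; apply: continuousM; [exact: cf|exact: cg].
have := Ck_onS Cf; have := Ck_onS Cg; move: Cf Cg => [cf df] [cg dg] Cg' Cf'.
split=> [x Ox|k]; first by apply: continuousM; [exact: cf|exact: cg].
have [dfk Cfk] := df k; have [dgk Cgk] := dg k; split=> [x Ox|].
  by apply: derivableM; [exact: dfk|exact: dgk].
apply: Ck_on_ext (Ck_onD oO (IH _ _ Cf' Cgk) (IH _ _ Cg' Cfk)) => // x Ox.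
by rewrite /partial deriveM//; [exact: dfk|exact: dgk].
Qed.

Lemma Ck_onV (m : nat) O f : open O -> (forall x, O x -> f x != 0) ->
  Ck_on m O f -> Ck_on m O (fun x => (f x)^-1).
Proof.
move=> oO f0; elim: m => [|m IH] Cf.
  have [cf _] := Cf.
  by split => // x Ox; apply: continuousV; [exact: f0|exact: cf].
have C' := Ck_onS Cf; move: Cf => [cf df].
split=> [x Ox|k]; first by apply: continuousV; [exact: f0|exact: cf].
have [dfk Cfk] := df k; split=> [x Ox|].
  by apply: derivableV; [exact: f0|exact: dfk].
have C := Ck_onM oO (Ck_onM oO (IH C') (IH C')) (Ck_onM oO (Ck_on_cst m O (-1)) Cfk).
apply: Ck_on_ext C => // x Ox.
rewrite /partial deriveV ?f0//; last exact: dfk.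
by rewrite -invfM -expr2 mulN1r mulrN scaleNr.
Qed.

Lemma smooth_on_ext O f g : open O ->
  (forall x, O x -> f x = g x) -> smooth_on O f -> smooth_on O g.
Proof. by move=> oO fg sf m; exact: Ck_on_ext (sf m). Qed.

Lemma smooth_on_cst O (c : R) : smooth_on O (fun=> c).
Proof. by move=> m; exact: Ck_on_cst. Qed.

Lemma smooth_onD O f g : open O ->
  smooth_on O f -> smooth_on O g -> smooth_on O (fun x => f x + g x).
Proof. by move=> oO sf sg m; exact: Ck_onD. Qed.

Lemma smooth_onM O f g : open O ->
  smooth_on O f -> smooth_on O g -> smooth_on O (fun x => f x * g x).
Proof. by move=> oO sf sg m; exact: Ck_onM. Qed.

Lemma smooth_onV O f : open O -> (forall x, O x -> f x != 0) ->
  smooth_on O f -> smooth_on O (fun x => (f x)^-1).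
Proof. by move=> oO f0 sf m; exact: Ck_onV. Qed.

Lemma smooth_on_partial O f k : smooth_on O f -> smooth_on O (partial k f).
Proof. by move=> sf m; have [_ /(_ k)[]] := sf m.+1. Qed.

Lemma smooth_on_continuous O f x : smooth_on O f -> O x -> {for x, continuous f}.
Proof. by move=> /(_ 0%N)[cf _] /cf. Qed.

Lemma smooth_on_sum O (I : Type) (r : seq I) (P : pred I)
    (F : I -> 'rV[R]_d -> R) : open O ->
  (forall i, smooth_on O (F i)) -> smooth_on O (fun x => \sum_(i <- r | P i) F i x).
Proof.
move=> oO sF; elim: r => [|i r IH].
  by under eq_fun do rewrite big_nil; exact: smooth_on_cst.
under eq_fun do rewrite big_cons; case: (P i) => //.
exact: smooth_onD.
Qed.

Lemma smooth_on_prod O (I : Type) (r : seq I) (P : pred I)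
    (F : I -> 'rV[R]_d -> R) : open O ->
  (forall i, smooth_on O (F i)) -> smooth_on O (fun x => \prod_(i <- r | P i) F i x).
Proof.
move=> oO sF; elim: r => [|i r IH].
  by under eq_fun do rewrite big_nil; exact: smooth_on_cst.
under eq_fun do rewrite big_cons; case: (P i) => //.
exact: smooth_onM.
Qed.

Lemma smooth_on_det O (p : nat) (F : 'rV[R]_d -> 'M[R]_p) : open O ->
  (forall i j, smooth_on O (fun x => F x i j)) -> smooth_on O (fun x => \det (F x)).
Proof.
move=> oO sF; apply: smooth_on_sum => // s.
by apply: smooth_onM => //; [exact: smooth_on_cst|exact: smooth_on_prod].
Qed.

(** By Cramer's rule, entries of the inverse are cofactors divided by the determinant. *)
Lemma smooth_on_invmx O (p : nat) (F : 'rV[R]_d -> 'M[R]_p) : open O ->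
  (forall x, O x -> F x \in unitmx) ->
  (forall i j, smooth_on O (fun x => F x i j)) ->
  forall i j, smooth_on O (fun x => invmx (F x) i j).
Proof.
move=> oO uF sF i j.
apply: (@smooth_on_ext O (fun x => (\det (F x))^-1 * cofactor (F x) j i)) => //.
  by move=> x Ox; rewrite /invmx uF// !mxE.
apply: smooth_onM => //.
  apply: smooth_onV => //; last exact: smooth_on_det.
  by move=> x /uF; rewrite unitmxE unitfE.
apply: smooth_onM => //; first exact: smooth_on_cst.
by apply: smooth_on_det => // k l; under eq_fun do rewrite !mxE; exact: sF.
Qed.

Lemma smooth_on_is_diff O f x : open O -> smooth_on O f -> O x ->
  is_diff x f (partial_lin f x).
Proof.
move=> oO sf Ox; apply: C1_is_diff => k.
  have [_ /(_ k)[dfk _]] := sf 1%N.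
  exact: filterS (open_nbhs_nbhs (conj oO Ox)).
exact: smooth_on_continuous (smooth_on_partial k sf) Ox.
Qed.
End multivariate_calculus.

(** * Measurability and dominated convergence *)

Lemma is_derive0P {R : realType} (F : R -> R) (l : R) :
  is_derive (0 : R) (1 : R) F l <->
  (fun s => s^-1 * (F s - F 0)) @ (0 : R)^' --> l.
Proof.
have E : (fun s : R => s^-1 *: ((F \o shift 0) (s *: (1 : R)) - F 0)) =
    (fun s => s^-1 * (F s - F 0)).
  by apply/funext => s /=; rewrite addr0 [_%:A]mulr1.
split=> [[]|cv].
  by rewrite /derivable /derive E => cv <-.
apply: DeriveDef; rewrite /derivable /derive E; first by apply/cvg_ex; exists l.
exact/cvg_lim.
Qed.

(** * Real integrals and differentiation under the integral sign *)

Section measure_facts.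
Context {disp : measure_display} {T : measurableType disp} {R : realType}.
Variable mu : {measure set T -> \bar R}.

Lemma integrable_dominated (f g : T -> R) :
  measurable_fun setT f -> (forall x, `|f x| <= g x) ->
  mu.-integrable setT (EFin \o g) -> mu.-integrable setT (EFin \o f).
Proof.
move=> mf fg ig; apply: le_integrable ig => //; first exact/measurable_EFinP.
by move=> x _ /=; rewrite lee_fin (le_trans (fg x))// ler_norm.
Qed.

Lemma integrableD_EFin (f g : T -> R) :
  mu.-integrable setT (EFin \o f) -> mu.-integrable setT (EFin \o g) ->
  mu.-integrable setT (EFin \o (fun x => f x + g x)).
Proof. by move=> hf hg; exact: (integrableD measurableT hf hg). Qed.

Lemma integrableZ_EFin (k : R) (f : T -> R) :
  mu.-integrable setT (EFin \o f) ->
  mu.-integrable setT (EFin \o (fun x => k * f x)).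
Proof. by move=> hf; exact: (integrableZl measurableT k hf). Qed.

Lemma integrable_measurable (f : T -> R) :
  mu.-integrable setT (EFin \o f) -> measurable_fun setT f.
Proof. by move=> /integrableP[/measurable_EFinP]. Qed.

Lemma integrable_sum_EFin (I : Type) (r : seq I) (f : I -> T -> R) :
  (forall i, mu.-integrable setT (EFin \o f i)) ->
  mu.-integrable setT (EFin \o (fun x => \sum_(i <- r) f i x)).
Proof.
move=> hf; have := integrable_sum measurableT r (P := xpredT) (fun i _ => hf i).
by apply: eq_integrable => // x _ /=; rewrite sumEFin.
Qed.

Lemma Rintegral_sum (I : Type) (r : seq I) (f : I -> T -> R) :
  (forall i, mu.-integrable setT (EFin \o f i)) ->
  \int[mu]_x (\sum_(i <- r) f i x) = \sum_(i <- r) \int[mu]_x f i x.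
Proof.
move=> hf; elim: r => [|i r IH].
  rewrite big_nil (@eq_Rintegral _ _ _ _ _ (cst 0)) ?Rintegral_cst ?mul0r//.
    by move=> x _; rewrite big_nil.
rewrite big_cons -IH -RintegralD//; last exact: integrable_sum_EFin.
by apply: eq_Rintegral => x _; rewrite big_cons.
Qed.

Lemma ae_eq_Rintegral (f g : T -> R) :
  measurable_fun setT f -> measurable_fun setT g ->
  {ae mu, forall x, f x = g x} -> \int[mu]_x f x = \int[mu]_x g x.
Proof.
move=> mf mg fg; rewrite /Rintegral; congr fine.
apply: ae_eq_integral => //; [exact/measurable_EFinP|exact/measurable_EFinP|].
by apply: filterS fg => x /= ->.
Qed.

Lemma measurable_bounded_integrableT (f : T -> R) (c : R) :
  (mu setT < +oo)%E -> measurable_fun setT f -> (forall x, `|f x| <= c) ->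
  mu.-integrable setT (EFin \o f).
Proof.
move=> muT mf fc; apply: measurable_bounded_integrable => //.
by exists c; split; rewrite ?num_real// => e ce x _ /=; apply: le_trans (fc x) (ltW ce).
Qed.

(** Dominated convergence is a statement about sequences, so the derivative at 0 is tested along
    arbitrary nonzero sequences tending to 0. Only increments from s = 0 have to be dominated. *)
Lemma is_derive_integral_dominated (h : R -> T -> R) (p g : T -> R) :
  (forall s, `|s| <= 1 -> measurable_fun setT (h s)) ->
  measurable_fun setT p ->
  mu.-integrable setT (EFin \o h 0) -> mu.-integrable setT (EFin \o g) ->
  (forall s x, `|s| <= 1 -> `|h s x - h 0 x| <= `|s| * g x) ->
  {ae mu, forall x, is_derive (0 : R) (1 : R) (h^~ x) (p x)} ->
  [/\ forall s, `|s| <= 1 -> mu.-integrable setT (EFin \o h s),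
      mu.-integrable setT (EFin \o p) &
      is_derive (0 : R) (1 : R) (fun s => \int[mu]_x h s x) (\int[mu]_x p x)].
Proof.
move=> mh mp ih0 ig hg hp.
have g_ge0 x : 0 <= g x.
  by have := @hg 1 x; rewrite normr1 mul1r => /(_ (lexx _)); apply: le_trans.
have ih s : `|s| <= 1 -> mu.-integrable setT (EFin \o h s).
  move=> s1; apply: (@integrable_dominated _ (fun x => `|h 0 x| + g x)); first exact: mh.
    move=> x; rewrite -[h s x](subrK (h 0 x)) (le_trans (ler_normD _ _))// addrC lerD//.
    by rewrite (le_trans (hg _ _ s1))// ler_piMl.
  exact: integrableD_EFin (integrable_norm ih0) ig.
(* The quotient is set to 0 for |t| > 1, where nothing is assumed on [h t]; every term of a sequence
   is then measurable and dominated. *)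
pose q (t : R) x := if `|t| <= 1 then t^-1 * (h t x - h 0 x) else 0.
have qE t : `|t| <= 1 -> \int[mu]_x q t x =
    t^-1 * (\int[mu]_x h t x - \int[mu]_x h 0 x).
  move=> t1; rewrite -RintegralB//; last exact: ih.
  rewrite -RintegralZl//.
    by apply: eq_Rintegral => x _; rewrite /q t1.
  exact: (integrableB measurableT (ih _ t1) ih0).
have mq t : measurable_fun setT (q t).
  rewrite /q; case: (boolP (`|t| <= 1)) => // t1; apply: measurable_funM => //.
  by apply: measurable_funB; apply: mh; rewrite ?normr0.
have qg t x : t != 0 -> `|q t x| <= g x.
  rewrite /q; case: ifPn => [t1 t0|]; last by rewrite normr0.
  by rewrite normrM normfV ler_pdivrMl ?normr_gt0// hg.
have key (t : R^nat) : (forall n, t n != 0) -> t @ \oo --> (0 : R) ->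
    mu.-integrable setT (EFin \o p) /\
    \int[mu]_x q (t n) x @[n --> \oo] --> \int[mu]_x p x.
  move=> t0 tcvg.
  have mq' n : measurable_fun setT (EFin \o q (t n)) by exact/measurable_EFinP.
  have mp' : measurable_fun setT (EFin \o p) by exact/measurable_EFinP.
  have cvq : {ae mu, forall x, setT x ->
      (EFin \o q (t n)) x @[n --> \oo] --> (EFin \o p) x}.
    apply: filterS hp => x /is_derive0P/cvgr_dnbhsP/(_ t (conj t0 tcvg)) cvx _.
    apply: cvg_EFin; first exact: nearW.
    apply: cvg_trans cvx; apply: near_eq_cvg.
    have : \forall n \near \oo, `|t n| <= 1 by exact: (cvgr0_norm_le _ tcvg _ ltr01).
    by apply: filterS => n t1; rewrite /q /= t1.
  have domq : {ae mu, forall x n, setT x ->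
      (`|(EFin \o q (t n)) x| <= (EFin \o g) x)%E}.
    by apply: aeW => x n _; rewrite lee_fin qg.
  have [ip _ cv] := dominated_convergence measurableT mq' mp' cvq ig domq.
  split => //; apply: fine_cvg; rewrite fineK//.
  exact: integrable_fin_num.
(* Integrability of the derivative is part of the conclusion of dominated convergence; one
   particular sequence suffices for it. *)
have ip : mu.-integrable setT (EFin \o p).
  have hn n : @harmonic R n != 0 by rewrite invr_neq0// pnatr_eq0.
  by have [] := key _ hn cvg_harmonic.
split => //; apply/is_derive0P/cvgr_dnbhsP => t [t0 tcvg].
have [_] := key t t0 tcvg; apply: cvg_trans; apply: near_eq_cvg.
have : \forall n \near \oo, `|t n| <= 1 by exact: (cvgr0_norm_le _ tcvg _ ltr01).
by apply: filterS => n t1; rewrite qE.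
Qed.
End measure_facts.

Lemma gradient_is_derive {R : realType} {n : nat} (W : 'M[R]_n -> R)
    (A G B : 'M[R]_n) :
  is_gradient W A G -> is_derive (0 : R) (1 : R) (fun s => W (A + s *: B)) (frob G B).
Proof.
move=> dW; have diffW : differentiable W A by exact: (@ex_diff _ _ _ _ _ _ _ dW).
have := @is_derive_line _ _ W A B 0; rewrite scale0r addr0.
rewrite (deriveE _ diffW) (@diff_val _ _ _ _ _ _ _ dW); apply.
exact: diff_derivable.
Qed.

(** * Measurability of matrix fields and of their gradients *)

Section measurable_matrices.
Context {disp : measure_display} {T : measurableType disp} {R : realType}.

(** Measurability is given entry by entry, and an open set of matrices is a countable union of boxes
    with rational centre and radius 1/(k + 1). *)
Lemma measurable_mx_preimage_open (m n : nat) (A : T -> 'M[R]_(m, n))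
    (O : set 'M[R]_(m, n)) :
  (forall i j, measurable_fun setT (fun x => A x i j)) -> open O ->
  measurable (A @^-1` O).
Proof.
move=> mA oO.
pose box (q : 'M[rat]_(m, n) * nat) : set 'M[R]_(m, n) :=
  [set B | forall i j, `|B i j - ratr (q.1 i j)| < q.2.+1%:R^-1].
(* Boxes that leave [O] contribute the empty set, so that the union runs over the whole countable
   index type. *)
pose F q : set T := if `[< box q `<=` O >] then A @^-1` box q else set0.
have -> : A @^-1` O = \bigcup_q F q.
  apply/seteqP; split => [x Ox|x [q _]]; last first.
    by rewrite /F; case: asboolP => // qO; exact: qO.
  have /nbhs_ballP[e /= e0 He] : nbhs (A x) O by exact: open_nbhs_nbhs.
  have [k ke] : exists k : nat, 2 * k.+1%:R^-1 < e :> R.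
    pose k := Num.bound (2 / e); exists k.
    rewrite ltr_pdivrMr// mulrC -ltr_pdivrMr// (lt_le_trans (archi_boundP _))//.
      by rewrite divr_ge0// ltW.
    by rewrite ler_nat.
  have k0 : 0 < k.+1%:R^-1 :> R by rewrite invr_gt0.
  have hq i j : exists q : rat, `|A x i j - ratr q| < k.+1%:R^-1.
    have [|q] := @rat_in_itvoo R (A x i j - k.+1%:R^-1) (A x i j + k.+1%:R^-1).
      by rewrite ltrBlDr -addrA ltrDl addr_gt0.
    by rewrite in_itv/= -ltr_distlC => h; exists q.
  pose Q : 'M[rat]_(m, n) := \matrix_(i, j) sval (cid (hq i j)).
  have hQ i j : `|A x i j - ratr (Q i j)| < k.+1%:R^-1.
    by rewrite mxE; case: cid.
  have sub : box (Q, k) `<=` O.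
    move=> B hB; apply: He; rewrite -ball_normE /=; apply: le_lt_trans ke.
    apply: mx_norm_leP => [|i j]; first by rewrite mulr_ge0// ltW.
    rewrite !mxE -(subrKA (ratr (Q i j))) (le_trans (ler_normD _ _))//.
    rewrite mulr_natl mulr2n lerD//; first exact/ltW/hQ.
    by rewrite distrC; exact/ltW/hB.
  exists (Q, k) => //; rewrite /F; case: asboolP => // _ i j; exact: hQ.
apply: countable_bigcupT_measurable; first exact: countableP.
move=> q; rewrite /F; case: asboolP => // _.
have -> : A @^-1` box q = \bigcap_(i in setT) \bigcap_(j in setT)
    ((fun x => A x i j) @^-1` [set y | `|y - ratr (q.1 i j)| < q.2.+1%:R^-1]).
  by apply/seteqP; split=> [x h i _ j _|x h i j]; apply: h.
apply: fin_bigcap_measurable => // i _; apply: fin_bigcap_measurable => // j _.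
rewrite -[X in measurable X]setTI; apply: mA => //.
apply: open_measurable.
have -> : [set y | `|y - ratr (q.1 i j)| < q.2.+1%:R^-1] =
    ball (ratr (q.1 i j) : R) q.2.+1%:R^-1.
  by rewrite -ball_normE; apply/funext => y /=; rewrite distrC.
exact: ball_open.
Qed.

Lemma measurable_mx_comp (m n : nat) (A : T -> 'M[R]_(m, n)) (W : 'M[R]_(m, n) -> R) :
  (forall i j, measurable_fun setT (fun x => A x i j)) -> continuous W ->
  measurable_fun setT (W \o A).
Proof.
move=> mA cW; apply: (measurability _ (RGenOInfty.measurableE R)).
move=> _ [_ [a ->] <-]; rewrite setTI comp_preimage.
apply: measurable_mx_preimage_open => //.
by apply: open_comp; [move=> ? _; exact: cW|exact: interval_open].
Qed.

(** Each entry of the gradient is a pointwise limit of difference quotients along a matrix unit,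
    with steps 1/(k + 1). This replaces a measurable choice of decomposition. *)
Lemma measurable_gradient (n : nat) (A P : T -> 'M[R]_n) (W : 'M[R]_n -> R)
    (D : set T) :
  (forall i j, measurable_fun setT (fun x => A x i j)) -> continuous W ->
  (forall x, D x -> is_gradient W (A x) (P x)) ->
  forall i j, measurable_fun D (fun x => P x i j).
Proof.
move=> mA cW dW i j.
apply: (@measurable_fun_cvg _ _ _ _ (fun k x =>
  k.+1%:R * (W (A x + k.+1%:R^-1 *: delta_mx i j) - W (A x)))) => [k|x Dx].
  apply: measurable_funTS; apply: measurable_funM => //; apply: measurable_funB.
    apply: (@measurable_mx_comp _ _ (fun x => A x + _) W) => // a b.
    under eq_fun do rewrite mxE.
    exact: measurable_funD.
  exact: measurable_mx_comp.
have := gradient_is_derive (delta_mx i j) (dW x Dx); rewrite frob_delta.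
have hn (k : nat) : @harmonic R k != 0 by rewrite invr_neq0// pnatr_eq0.
move=> /is_derive0P/cvgr_dnbhsP/(_ harmonic (conj hn (@cvg_harmonic R))).
by rewrite /harmonic scale0r addr0; under eq_fun do rewrite invrK.
Qed.
End measurable_matrices.

(** * Geometry and volume of the manifold *)

Section compact_induction.
Import finmap.
Context {R : realType} {d : nat} (M : closedRiemannianManifold R d).

(** The atlas may be uncountable; compactness leaves a finite union, for which closure of [P] under
    binary unions is enough. *)
Lemma compact_induction (P : set M -> Prop) :
  P set0 -> (forall U V, P U -> P V -> P (U `|` V)) ->
  (forall p, exists U, [/\ open U, U p & P U]) ->
  exists2 U, setT `<=` U & P U.
Proof.
move=> P0 PU Ploc.
have [U HU] := choice Ploc.
have := @space_compact _ _ M; rewrite compact_cover => /(_ M setT U).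
case=> [p _|p _|D _ HD]; first by have [] := HU p.
  by exists p => //; have [] := HU p.
exists (\bigcup_(p in [set` D]) U p) => //.
rewrite bigcup_fset; elim/big_ind : _ => // p _; by have [] := HU p.
Qed.
End compact_induction.

Section manifold_geometry.
Context {R : realType} {d : nat} (M : closedRiemannianManifold R d).
Implicit Types (i j : atlas M) (p : M).

Lemma dom_chart_at p : dom (chart_at p) p.
Proof. exact: (projT2 (cid (dom_cover p))). Qed.

Lemma chart_overlap_open i j : open (phi i @` (dom i `&` dom j)).
Proof.
rewrite openE => _ [p [ip jp] <-]; rewrite /interior.
have Ux : (phi i @` dom i) (phi i p) by exists p.
have nU := open_nbhs_nbhs (conj (@phi_open _ _ M i) Ux).
have : \forall x \near phi i p, dom j (psi i x).
  have := psi_continuous Ux; apply; rewrite phiK//.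
  exact: open_nbhs_nbhs (conj (@dom_open _ _ M j) jp).
apply: filterS2 nU => _ [q iq <-]; rewrite phiK// => jq.
by exists q.
Qed.

Lemma metric_unit i p : dom i p -> metric i (phi i p) \in unitmx.
Proof.
move=> ip; rewrite -row_free_unit -kermx_eq0; apply/negP => /negP ker0.
have [v vk v0] : exists2 v : 'rV[R]_d, (v <= kermx (metric i (phi i p)))%MS & v != 0.
  by have /rowV0Pn[v] := ker0; exists v.
have Ux : (phi i @` dom i) (phi i p) by exists p.
have := metric_posdef Ux v0; move/sub_kermxP: vk => ->.
by rewrite mul0mx mxE ltxx.
Qed.

Lemma differentiable_rV (V : normedModType R) (m : nat) (f : V -> 'rV[R]_m) (x : V) :
  (forall k, differentiable (fun y => f y 0 k) x) -> differentiable f x.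
Proof.
move=> df; have -> : f = \sum_k (fun y => f y 0 k *: delta_mx 0 k).
  by apply/funext => y; rewrite fct_sumE -row_sum_delta.
by apply: differentiable_sum => k; exact: differentiableZl.
Qed.

Lemma transition_differentiable i j p : dom i p -> dom j p ->
  differentiable (phi j \o @psi _ _ M i) (phi i p).
Proof.
move=> ip jp; apply: differentiable_rV => k.
have Op : (phi i @` (dom i `&` dom j)) (phi i p) by exists p.
have dt := smooth_on_is_diff (@chart_overlap_open i j)
  (@transition_smooth _ _ M i j k) Op.
exact: (@ex_diff _ _ _ _ _ _ _ dt).
Qed.

Lemma inner_chart (X Y : vfield M) i p : is_vfield X -> is_vfield Y -> dom i p ->
  inner X Y p = (X i p *m metric i (phi i p) *m (Y i p)^T) 0 0.
Proof.
move=> vX vY ip; rewrite /inner; set j := chart_at p.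
have jp : dom j p := dom_chart_at p.
rewrite (vX _ _ _ jp ip) (vY _ _ _ jp ip) (metric_compat jp ip) /=.
by rewrite trmx_mul !mulmxA.
Qed.

(** The chain rule multiplies the row of partial derivatives by J^T, while g_i = J g_j J^T; hence
    J^T g_i^-1 J = g_j^-1, the transformation law of components. *)
Lemma grad_is_vfield (b : M -> R) : smooth_fun b -> is_vfield (grad b).
Proof.
move=> sb i j p ip jp.
set J := 'J (phi j \o psi i) (phi i p).
have gE := metric_compat ip jp; rewrite /= -/J in gE.
have Up : (phi i @` dom i) (phi i p) by exists p.
have Uq : (phi j @` dom j) (phi j p) by exists p.
have Op : (phi i @` (dom i `&` dom j)) (phi i p) by exists p.
(* Invertibility of the Jacobian is read off from metric compatibility, the determinant of the
   metric being nonzero. *)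
have uJ : J \in unitmx.
  have := metric_unit ip; rewrite gE unitmxE !det_mulmx unitrM unitrM.
  by rewrite unitmxE => /andP[/andP[]].
have dj := smooth_on_is_diff (@phi_open _ _ M j) (sb j) Uq.
have rowE : \row_k partial k (b \o psi i) (phi i p) =
    (\row_k partial k (b \o psi j) (phi j p)) *m J^T.
  apply/rowP => k; rewrite [LHS]mxE.
  have near_eq : \forall x \near phi i p,
      (b \o psi i) x = ((b \o psi j) \o (phi j \o psi i)) x.
    apply: filterS (open_nbhs_nbhs (conj (@chart_overlap_open i j) Op)).
    by move=> _ [q [iq jq] <-] /=; rewrite (phiK iq) phiK.
  rewrite /partial (near_eq_derive _ near_eq).
  have qE : (phi j \o psi i) (phi i p) = phi j p by rewrite /= phiK.
  have dq : differentiable (b \o psi j) ((phi j \o psi i) (phi i p)).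
    by rewrite qE; exact: (@ex_diff _ _ _ _ _ _ _ dj).
  rewrite deriveE; last first.
    by apply: differentiable_comp => //; exact: transition_differentiable.
  rewrite diff_comp//; last exact: transition_differentiable.
  rewrite /= (phiK ip) (@diff_val _ _ _ _ _ _ _ dj) /partial_lin.
  rewrite [RHS]mxE; apply: eq_bigr => l _; rewrite mulrC [in RHS]mxE; congr (_ * _).
  rewrite -deriveE; last exact: transition_differentiable.
  rewrite deriveEjacobian; last exact: transition_differentiable.
  by rewrite -/J -rowE [RHS]mxE [LHS]mxE.
rewrite /grad rowE -!mulmxA; congr (_ *m _).
have ug := metric_unit jp; have uh := metric_unit ip.
move: uh ug gE; move: (metric i _) (metric j _) => h g uh ug gE.
have hZ (Z : 'M[R]_d) : J *m (g *m (J^T *m Z)) = h *m Z.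
  by rewrite gE !mulmxA.
rewrite -[LHS]mulmx1 -[RHS](mulKmx ug); congr (_ *m _).
by rewrite -[RHS](mulKmx uJ) hZ mulKVmx// mulVmx.
Qed.

Lemma smooth_metric_inv i k l :
  smooth_on (phi i @` dom i) (fun x => invmx (metric i x : 'M[R]_d) k l).
Proof.
apply: smooth_on_invmx; first exact: (@phi_open _ _ M i).
  by move=> _ [p ip <-]; exact: metric_unit.
by move=> a b; exact: metric_smooth.
Qed.

Lemma grad_smooth (b : M -> R) : smooth_fun b -> smooth_vfield (grad b).
Proof.
move=> sb; split; first exact: grad_is_vfield.
move=> i k; have oU := @phi_open _ _ M i.
apply: (@smooth_on_ext _ _ _ (fun x => \sum_l partial l (b \o psi i) x *
    invmx (metric i x) l k)) => //.
  move=> _ [p ip <-]; rewrite /grad mxE phiK//.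
  by apply: eq_bigr => l _; rewrite mxE.
apply: smooth_on_sum => // l; apply: smooth_onM => //.
  exact/smooth_on_partial/sb.
exact: smooth_metric_inv.
Qed.

Lemma inner_expand (X Y : vfield M) p (s : R) :
  inner (fun c q => X c q + s *: Y c q) (fun c q => X c q + s *: Y c q) p =
  inner X X p + s * (2 * inner X Y p) + s ^+ 2 * inner Y Y p.
Proof.
rewrite /inner; set i := chart_at p; set g := metric i _.
have Ux : (phi i @` dom i) (phi i p) by exists p => //; exact: dom_chart_at.
have gT : g^T = g by exact: Defs.metric_sym Ux.
have T (Z : 'M[R]_1) : Z 0 0 = Z^T 0 0 by rewrite mxE.
have YX : (Y i p *m g *m (X i p)^T) 0 0 = (X i p *m g *m (Y i p)^T) 0 0.
  by rewrite [LHS]T !trmx_mul trmxK gT mulmxA.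
have -> : (X i p + s *: Y i p)^T = (X i p)^T + s *: (Y i p)^T.
  by apply/matrixP => a b; rewrite !mxE.
rewrite !mulmxDl !mulmxDr -!scalemxAl -!scalemxAr.
move: YX; move: (X i p *m g *m _) (X i p *m g *m _).
move=> a b; move: (Y i p *m g *m _) (Y i p *m g *m _).
move=> c e; rewrite !mxE => ->; ring.
Qed.

Lemma inner_ge0 (X : vfield M) p : 0 <= inner X X p.
Proof.
rewrite /inner; set i := chart_at p.
have Ux : (phi i @` dom i) (phi i p) by exists p => //; exact: dom_chart_at.
have [->|X0] := eqVneq (X i p) 0; first by rewrite mul0mx mul0mx mxE.
exact/ltW/metric_posdef.
Qed.

(** Nonnegativity of the squares of X + Y and X - Y. It makes the mixed product of two
    square-integrable fields integrable. *)
Lemma inner_AMGM (X Y : vfield M) p :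
  `|2 * inner X Y p| <= inner X X p + inner Y Y p.
Proof.
rewrite ler_norml; apply/andP; split.
  by have := inner_ge0 (fun c q => X c q + 1 *: Y c q) p; rewrite inner_expand; lra.
by have := inner_ge0 (fun c q => X c q + (-1) *: Y c q) p; rewrite inner_expand; lra.
Qed.

Lemma measurable_open (U : set M) : open U -> measurable (U : set (borelT M)).
Proof. by move=> oU; apply: sub_sigma_algebra. Qed.

Lemma continuous_borel (f : M -> R) :
  continuous f -> measurable_fun setT (f : borelT M -> R).
Proof.
move=> cf; apply: (measurability _ (RGenOInfty.measurableE R)).
move=> _ [_ [a ->] <-]; rewrite setTI; apply: measurable_open.
by apply: open_comp; [move=> ? _; exact: cf|exact: interval_open].
Qed.

Lemma continuous_chart (f : M -> R) :
  (forall i, exists2 F : 'rV[R]_d -> R, smooth_on (phi i @` dom i) F &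
    forall p, dom i p -> f p = F (phi i p)) -> continuous f.
Proof.
move=> H p; have ip := dom_chart_at p; move: (chart_at p) ip => i ip.
have [F sF fF] := H i.
have Ux : (phi i @` dom i) (phi i p) by exists p.
apply: (@near_eq_continuous _ _ (F \o phi i)).
  by apply: filterS (open_nbhs_nbhs (conj (@dom_open _ _ M i) ip)) => q /fF.
apply: continuous_comp; first exact: phi_continuous.
exact: smooth_on_continuous Ux.
Qed.

Lemma smooth_fun_continuous (b : M -> R) : smooth_fun b -> continuous b.
Proof.
move=> sb; apply: continuous_chart => i; exists (b \o psi i); first exact: sb.
by move=> p ip /=; rewrite phiK.
Qed.

Lemma inner_continuous (X Y : vfield M) :
  smooth_vfield X -> smooth_vfield Y -> continuous (inner X Y).
Proof.
move=> [vX sX] [vY sY]; apply: continuous_chart => i.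
exists (fun x => (X i (psi i x) *m metric i x *m (Y i (psi i x))^T) 0 0); last first.
  by move=> p ip; rewrite phiK// (inner_chart vX vY ip).
have oU := @phi_open _ _ M i.
under eq_fun do rewrite mxE.
apply: smooth_on_sum => // k; apply: smooth_onM => //.
  under eq_fun do rewrite mxE.
  apply: smooth_on_sum => // l; apply: smooth_onM => //.
  exact: metric_smooth.
under eq_fun do rewrite mxE; exact: sY.
Qed.

Lemma continuous_bounded (f : M -> R) : continuous f ->
  exists c, forall p, `|f p| <= c.
Proof.
move=> cf; have := continuous_compact (continuous_subspaceT cf) (@space_compact _ _ M).
move=> /compact_bounded[c [_ hc]]; exists (c + 1) => p.
by apply: (hc (c + 1)); rewrite ?ltrDl//; exists p.
Qed.
End manifold_geometry.

(** * Finiteness of the Riemannian volume *)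

Section volume.
Context {R : realType}.

(* No measurability is required, the integral of a nonnegative function being
   a supremum over the simple functions below it. *)
Lemma le_integral_ge0 (disp : measure_display) (T : measurableType disp)
    (mu : {measure set T -> \bar R}) (f g : T -> \bar R) :
  (forall x, 0 <= f x)%E -> (forall x, f x <= g x)%E ->
  (\int[mu]_x f x <= \int[mu]_x g x)%E.
Proof.
move=> f0 fg; have g0 x : (0 <= g x)%E by exact: le_trans (fg x).
rewrite !ge0_integralTE//; apply: ereal_sup_le => _ [h /= hf <-].
by exists h => //= x; exact: le_trans (fg x).
Qed.

(** Induction on the dimension: the integral over a slice is bounded, and it vanishes when the first
    coordinate leaves an interval of length 2r. Comparing with a multiple of an indicator avoids any
    question of measurability of the slice integrals. *)
Lemma lebesgue_int_box (d : nat) (f : 'rV[R]_d -> \bar R) (x0 : 'rV[R]_d) (r c : R) :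
  0 <= r -> 0 <= c -> (forall x, 0 <= f x)%E -> (forall x, f x <= c%:E)%E ->
  (forall x : 'rV[R]_d, (forall k, `|x 0 k - x0 0 k| <= r) \/ f x = 0%E) ->
  (0 <= lebesgue_int f <= (c * (2 * r) ^+ d)%:E)%E.
Proof.
move=> r0; elim: d f x0 c => [|d IH] f x0 c c0 f0 fc supp.
  by rewrite /= f0/= expr0 mulr1.
pose a := x0 0 0.
pose F t := lebesgue_int (fun y : 'rV[R]_d => f (row_mx (t%:M : 'M[R]_1) y)).
have rowS t (y : 'rV[R]_d) (k : 'I_d) :
    (row_mx (t%:M : 'M[R]_1) y : 'rV[R]_d.+1) 0 (lift ord0 k) = y 0 k.
  by rewrite -[RHS](row_mxEr (t%:M : 'M[R]_1));
    congr (fun_of_matrix _ _ _); exact/val_inj.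
have row0 t (y : 'rV[R]_d) : (row_mx (t%:M : 'M[R]_1) y : 'rV[R]_d.+1) 0 0 = t.
  transitivity ((t%:M : 'M[R]_1) 0 0); last by rewrite mxE eqxx.
  by rewrite -[RHS](row_mxEl _ y); congr (fun_of_matrix _ _ _); exact/val_inj.
have FB t : (0 <= F t <= (c * (2 * r) ^+ d)%:E)%E.
  apply: (IH _ (\row_k x0 0 (lift ord0 k))) => // y.
  have [h|->] := supp (row_mx (t%:M : 'M[R]_1) y); [left|by right].
  by move=> k; rewrite mxE; have := h (lift ord0 k); rewrite rowS.
(* On such a slice f is identically 0, and the induction hypothesis with c = 0 pins the integral to
   0. *)
have F0 t : r < `|t - a| -> F t = 0%E.
  move=> ht; have f0' (y : 'rV[R]_d) : f (row_mx (t%:M : 'M[R]_1) y) = 0%E.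
    have [h|//] := supp (row_mx (t%:M : 'M[R]_1) y).
    by have := h 0; rewrite row0 leNgt ht.
  have := IH (fun y => f (row_mx (t%:M : 'M[R]_1) y)) 0 0 (lexx _).
  rewrite mul0r => /(_ _ _ _)H; apply/eqP; rewrite eq_le andbC; apply: H => y.
  - by rewrite f0'.
  - by rewrite f0'.
  - by right.
have c'0 : 0 <= c * (2 * r) ^+ d by rewrite mulr_ge0// exprn_ge0// mulr_ge0.
rewrite [lebesgue_int f]/=; apply/andP; split.
  by apply: integral_ge0 => t _; have /andP[] := FB t.
pose I := `[a - r, a + r]%classic.
apply: (@le_trans _ _
  (\int[@lebesgue_measure R]_t ((c * (2 * r) ^+ d)%:E * (\1_I t)%:E))%E).
  apply: le_integral_ge0 => t; first by have /andP[] := FB t.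
  rewrite indicE; case: (boolP (t \in I)) => [_|].
    by rewrite mule1; have /andP[] := FB t.
  rewrite mule0 => tI; rewrite -/(F t) F0// ltNge; apply: contra tI.
  by move=> h; apply/mem_set; rewrite /I /= in_itv/= -ler_distl.
rewrite ge0_integralZl_EFin//; last first.
  apply/measurable_EFinP; apply: measurable_indic; exact: measurable_itv.
have -> : (\int[@lebesgue_measure R]_t (\1_I t)%:E = lebesgue_measure I)%E.
  rewrite integral_indic; [|exact: measurableT|exact: measurable_itv].
  by congr (lebesgue_measure _); exact: setIT.
have muI : (lebesgue_measure I <= (2 * r)%:E)%E.
  have := lebesgue_measure_itv `[a - r, a + r]; rewrite -/I => ->.
  case: ifP => _ /=; last by rewrite lee_fin mulr_ge0.
  by rewrite -EFinB lee_fin; lra.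
by rewrite exprSr mulrA [leRHS]EFinM lee_wpmul2l// lee_fin.
Qed.

Context {d : nat} (M : closedRiemannianManifold R d).

(** On a small coordinate ball the volume density exceeds its value at the centre by at most 1, and
    the ball lies in a cube. *)
Lemma vol_locally_finite (p : M) :
  exists U : set M, [/\ open U, U p & (vol M U < +oo)%E].
Proof.
have ip := dom_chart_at p; move: (chart_at p) ip => i ip.
have oU := @phi_open _ _ M i.
have Ux : (phi i @` dom i) (phi i p) by exists p.
pose g x := Num.sqrt (\det (metric i x)).
have cg : {for phi i p, continuous g}.
  apply: (@continuous_comp _ _ _ (fun x => \det (metric i x)) Num.sqrt).
    apply: (@smooth_on_continuous _ _ (phi i @` dom i)) Ux.
    by apply: smooth_on_det => // k l; exact: metric_smooth.
  exact: sqrt_continuous.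
pose c := g (phi i p) + 1.
have c0 : 0 <= c by rewrite addr_ge0// sqrtr_ge0.
have : \forall x \near phi i p, (phi i @` dom i) x /\ g x <= c.
  apply: filterI; first exact: open_nbhs_nbhs.
  have cg1 : \forall x \near phi i p, `|g x - g (phi i p)| <= 1.
    exact: (cvgr_distC_le _ _ cg _ ltr01).
  apply: filterS cg1 => x.
  by rewrite /c => /(le_trans (ler_norm _)); lra.
move=> /nbhs_ballP[r /= r0 hr].
pose V := dom i `&` (phi i @^-1` ball (phi i p) r).
have oV : open V.
  rewrite openE => q [iq qr]; rewrite /interior; apply: filterI.
    exact: open_nbhs_nbhs (conj (@dom_open _ _ M i) iq).
  apply: phi_continuous => //; apply: open_nbhs_nbhs; split => //.
  exact: ball_open.
exists V; split => //; first by split => //; exact: ballxx.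
rewrite (@vol_chart _ _ M i); [|exact: measurable_open|by move=> q []].
pose f x := (\1_(phi i @` V) x * g x)%:E.
have f0 x : (0 <= f x)%E by rewrite lee_fin mulr_ge0// sqrtr_ge0.
have fV x : ~ (phi i @` V) x -> f x = 0%E.
  by move=> nVx; rewrite /f indicE memNset// mul0r.
have ballV x : (phi i @` V) x -> ball (phi i p) r x by move=> [q [_ qr] <-].
have fc x : (f x <= c%:E)%E.
  have [Vx|/fV->] := pselect ((phi i @` V) x); last by rewrite lee_fin.
  by rewrite /f indicE mem_set// mul1r lee_fin; have [] := hr x (ballV x Vx).
have supp (x : 'rV[R]_d) : (forall k, `|x 0 k - phi i p 0 k| <= r) \/ f x = 0%E.
  have [Vx|/fV->] := pselect ((phi i @` V) x); [left => k|by right].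
  have := ballV x Vx; rewrite -ball_normE /= distrC => /ltW; apply: le_trans.
  by have := mx_coord_le (x - phi i p) 0 k; rewrite !mxE.
have /andP[_] := lebesgue_int_box (ltW r0) c0 f0 fc supp.
by move=> /le_lt_trans; apply; rewrite ltry.
Qed.

(** Through finite volume, continuous functions become integrable and L^2 is contained in L^1. *)
Lemma vol_finite : (vol M setT < +oo)%E.
Proof.
have [|U V [mU hU] [mV hV]|p|U UT [mU hU]] := @compact_induction _ _ M
  (fun U => measurable (U : set (borelT M)) /\ (vol M U < +oo)%E).
- by split; [exact: measurable0|rewrite measure0].
- split; first exact: measurableU.
  by rewrite (le_lt_trans (measureU2 _ mU mV))// lte_add_pinfty.
- have [U [oU Up hU]] := vol_locally_finite p.
  by exists U; split => //; split => //; exact: measurable_open.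
by have -> : setT = U by apply/seteqP; split.
Qed.
End volume.

(** * Measurable and integrable functions and vector fields *)

Section manifold_integration.
Context {R : realType} {d : nat} (M : closedRiemannianManifold R d).

Lemma continuous_borel_on (U : set M) (f : M -> R) : open U ->
  (forall p, U p -> {for p, continuous f}) ->
  measurable_fun (U : set (borelT M)) (f : borelT M -> R).
Proof.
move=> oU cf; apply: (measurability _ (RGenOInfty.measurableE R)).
move=> _ [_ [a ->] <-]; apply: measurable_open.
rewrite openE => p [Up fp]; rewrite /interior; apply: filterI.
  exact: open_nbhs_nbhs.
by apply: cf => //; apply: open_nbhs_nbhs; split => //; exact: interval_open.
Qed.

Lemma measurable_metric (i : atlas M) k l :
  measurable_fun (dom i : set (borelT M))
    (fun p : borelT M => metric i (phi i p) k l).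
Proof.
apply: continuous_borel_on; first exact: dom_open.
move=> p ip; have Ux : (phi i @` dom i) (phi i p) by exists p.
apply: (@continuous_comp _ _ _ (phi i) (fun x => metric i x k l)).
  exact: phi_continuous.
by apply: smooth_on_continuous Ux; exact: metric_smooth.
Qed.

(** [inner] is evaluated in a chart chosen point by point. On the domain of a fixed chart, chart
    independence replaces it by a measurable expression in the components. *)
Lemma inner_measurable (X Y : vfield M) :
  is_vfield X -> is_vfield Y ->
  (forall i k, measurable_fun (dom i : set (borelT M)) (fun p => X i p 0 k)) ->
  (forall i k, measurable_fun (dom i : set (borelT M)) (fun p => Y i p 0 k)) ->
  measurable_fun setT (inner X Y : borelT M -> R).
Proof.
move=> vX vY mX mY.
have [|U V [mU hU] [mV hV]|p|U UT [mU hU]] := @compact_induction _ _ M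
  (fun U => measurable (U : set (borelT M)) /\
     measurable_fun (U : set (borelT M)) (inner X Y : borelT M -> R)).
- by split; [exact: measurable0|exact: measurable_fun_set0].
- split; first exact: measurableU.
  exact/measurable_funU.
- exists (dom (chart_at p)); have ip := dom_chart_at p.
  move: (chart_at p) ip => i ip.
  have mU : measurable (dom i : set (borelT M)).
    by apply: measurable_open; exact: dom_open.
  split => //; first exact: dom_open.
  split => //.
  have mF : measurable_fun (dom i : set (borelT M)) (fun p : borelT M =>
     \sum_k (\sum_l X i p 0 l * metric i (phi i p) l k) * Y i p 0 k).
    apply: measurable_sum => k; apply: measurable_funM; last exact: mY.
    apply: measurable_sum => l; apply: measurable_funM; first exact: mX.
    exact: measurable_metric.
  apply: eq_measurable_fun mF => q /set_mem iq.
  rewrite (inner_chart vX vY iq) mxE.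
  apply: eq_bigr => k _; rewrite [in RHS]mxE; congr (_ * _).
  by rewrite mxE.
by have -> : setT = U by apply/seteqP; split.
Qed.

Lemma grad_measurable (b : M -> R) : smooth_fun b ->
  forall i k, measurable_fun (dom i : set (borelT M)) (fun p => grad b i p 0 k).
Proof.
move=> sb i k; have [_ sg] := grad_smooth sb.
apply: continuous_borel_on; first exact: dom_open.
move=> p ip; have Ux : (phi i @` dom i) (phi i p) by exists p.
apply: (@near_eq_continuous _ _ ((fun x => grad b i (psi i x) 0 k) \o phi i)).
  apply: filterS (open_nbhs_nbhs (conj (@dom_open _ _ M i) ip)) => q iq /=.
  by rewrite phiK.
apply: continuous_comp; first exact: phi_continuous.
exact: smooth_on_continuous (sg i k) Ux.
Qed.

Local Notation intg f := ((vol M).-integrable setT (EFin \o (f : borelT M -> R))).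

Lemma continuous_integrable (f : M -> R) : continuous f -> intg f.
Proof.
move=> cf; have [c hc] := continuous_bounded cf.
apply: (@measurable_bounded_integrableT _ _ _ _ _ c) => //; first exact: vol_finite.
exact: continuous_borel.
Qed.

Lemma inner_grad_integrable (b : M -> R) : smooth_fun b ->
  intg (inner (grad b) (grad b)).
Proof.
by move=> /grad_smooth sg; apply: continuous_integrable; exact: inner_continuous.
Qed.

Lemma L2_vfield_integrable (X : vfield M) : L2_vfield X -> intg (inner X X).
Proof.
move=> [vX mX fX]; apply/integrableP; split.
  by apply/measurable_EFinP; exact: inner_measurable.
apply: le_lt_trans fX; rewrite le_eqVlt; apply/orP; left; apply/eqP.
by apply: eq_integral => p _ /=; rewrite ger0_norm// inner_ge0.
Qed.

Lemma inner_grad_mixed_integrable (X : vfield M) (b : M -> R) :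
  L2_vfield X -> smooth_fun b -> intg (inner X (grad b)).
Proof.
move=> LX sb; have [vX mX _] := LX.
have [vg _] := grad_smooth sb.
apply: (@integrable_dominated _ _ _ _ _
    (fun p : borelT M => inner X X p + inner (grad b) (grad b) p)).
- exact: inner_measurable vX vg mX (grad_measurable sb).
- move=> p; apply: le_trans (inner_AMGM X (grad b) p).
  by rewrite normrM ger0_norm// ler_peMl// ler1n.
- exact: integrableD_EFin (L2_vfield_integrable LX) (inner_grad_integrable sb).
Qed.

Lemma L2_measurable (f : borelT M -> R) : L2 f -> measurable_fun setT f.
Proof. by move=> /sub_Lfun_mfun/set_mem. Qed.

Lemma L2_integrable_sqr (f : borelT M -> R) : L2 f -> intg (fun x => f x ^+ 2).
Proof. exact: Lfun2_integrable_sqr. Qed.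

Lemma L2_integrable (f : borelT M -> R) : L2 f -> intg f.
Proof.
move=> Lf; apply/Lfun1_integrable; apply: Lfun_subset12 Lf.
by rewrite ge0_fin_numE// vol_finite.
Qed.

Lemma L2_opp (f : borelT M -> R) : L2 f -> L2 (fun x => - f x).
Proof. by move=> Lf; exact: Lfun_oppr_closed Lf. Qed.
End manifold_integration.

(** * First variations and gradient flows *)

(** The growth bound passes to the limit in the difference quotient along a matrix unit; steps with
    |s| <= 1 produce the 2 + |A|. *)
Lemma gradient_bound {R : realType} {n : nat} (W : 'M[R]_n -> R) (c : R) (k : nat)
    (A G : 'M[R]_n) i j :
  polynomial_growth W c k -> is_gradient W A G ->
  `|G i j| <= `|c| * (2 + `|A|) ^+ k.
Proof.
move=> gW dW; apply/ler_addgt0Pr => e e0.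
have := gradient_is_derive (delta_mx i j) dW; rewrite frob_delta => /is_derive0P cv.
have n1 : \forall s \near (0 : R)^', `|s| <= 1 by apply: dnbhs0_le.
have n0 : \forall s \near (0 : R)^', s != 0 by exact: nbhs_dnbhs_neq.
have [s [[s1 s0] se]] :=
  filter_ex (filterI (filterI n1 n0) (cvgr_dist_le _ _ cv _ e0)).
rewrite -(subrK (s^-1 * (W (A + s *: delta_mx i j)
    - W (A + 0 *: delta_mx i j))) (G i j)).
rewrite addrC (le_trans (ler_normD _ _))// lerD//.
have D1 : `|s *: delta_mx i j : 'M[R]_n| <= `|s|.
  apply: mx_norm_leP => // a b; rewrite !mxE normrM ler_piMr//.
  by case: (_ && _); rewrite ?normr1 ?normr0.
rewrite scale0r addr0 normrM normfV ler_pdivrMl ?normr_gt0//.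
rewrite (le_trans (gW _ _))// [leRHS]mulrC.
apply: (@le_trans _ _ (`|c| * (1 + `|A| + `|s *: delta_mx i j : 'M[R]_n|) ^+ k
    * `|s *: delta_mx i j : 'M[R]_n|)).
  by rewrite !ler_wpM2r ?ler_norm// exprn_ge0// !addr_ge0.
rewrite ler_pM// ?mulr_ge0 ?exprn_ge0 ?addr_ge0// ler_wpM2l//.
case: (k) => // k'; rewrite ler_pXn2r// ?nnegrE ?addr_ge0//.
by have := le_trans D1 s1; lra.
Qed.

(** * Differentiation of the energies *)

Section first_variations.
Context {R : realType} {d : nat} {M : closedRiemannianManifold R d} {n : nat}.
Local Notation intg f := ((vol M).-integrable setT (EFin \o (f : borelT M -> R))).
Implicit Types (A B P G : mfield M n) (DA : mgradient M n).

Lemma integrable_bounded_mul (f b : borelT M -> R) (c : R) :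
  intg f -> measurable_fun setT b -> (forall x, `|b x| <= c) ->
  intg (fun x => f x * b x).
Proof.
move=> hf mb bc; apply: (@integrable_dominated _ _ _ _ _ (fun x => c * `|f x|)).
- by apply: measurable_funM => //; exact: integrable_measurable hf.
- by move=> x; rewrite normrM mulrC ler_wpM2r.
- by apply: integrableZ_EFin; exact: integrable_norm.
Qed.

Lemma smooth_mx_bounded B : smooth_mx B ->
  exists c, 0 <= c /\ forall x, `|B x| <= c.
Proof.
move=> sB; have [c hc] := choice (fun ij : 'I_n * 'I_n =>
  continuous_bounded (smooth_fun_continuous (sB ij.1 ij.2))).
exists (\sum_ij `|c ij|); split => [|x]; first exact: sumr_ge0.
apply: mx_norm_leP => [|i j]; first exact: sumr_ge0.
rewrite (le_trans (hc (i, j) x))//= (le_trans (ler_norm _))//.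
by rewrite (bigD1 (i, j))//= lerDl sumr_ge0.
Qed.

Lemma smooth_mx_measurable B i j : smooth_mx B ->
  measurable_fun setT (fun x => B x i j).
Proof. by move=> sB; apply: continuous_borel; exact: smooth_fun_continuous. Qed.

Lemma integrable_mx_mul P B i j : integrable_mx P -> smooth_mx B ->
  intg (fun x => P x i j * B x i j).
Proof.
move=> iP sB; have [c [_ hc]] := smooth_mx_bounded sB.
apply: (integrable_bounded_mul (c := c)) => //; first exact: iP.
  exact: smooth_mx_measurable.
by move=> x; rewrite (le_trans (mx_coord_le _ _ _)).
Qed.

Lemma Rintegral_frob P B : integrable_mx P -> smooth_mx B ->
  intg (fun x => frob (P x) (B x)) /\
  \int[vol M]_x frob (P x) (B x) = \sum_i \sum_j \int[vol M]_x (P x i j * B x i j).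
Proof.
move=> iP sB; split.
  by apply: integrable_sum_EFin => i; apply: integrable_sum_EFin => j;
    exact: integrable_mx_mul.
rewrite Rintegral_sum => [|i].
  by apply: eq_bigr => i _; rewrite Rintegral_sum// => j; exact: integrable_mx_mul.
by apply: integrable_sum_EFin => j; exact: integrable_mx_mul.
Qed.

Lemma first_variation_energy (W : 'M[R]_n -> R) (c : R) (k : nat) A DA P B :
  polynomial_growth W c k -> H1_mx A DA ->
  intg (fun x => W (A x)) -> intg (fun x => (1 + `|A x|) ^+ k) ->
  integrable_mx P -> {ae vol M, forall x, is_gradient W (A x) (P x)} ->
  smooth_mx B ->
  first_variation (energy W) A DA B
    (- distr_laplacian_pairing A B + \int[vol M]_x frob (P x) (B x)).
Proof.
move=> gW H1A iW iA iP dW sB.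
have cW := polynomial_growth_continuous gW.
have mA i j : measurable_fun setT (fun x => A x i j).
  by have [/L2_measurable] := H1A i j.
have mB i j := smooth_mx_measurable i j sB.
have [b [b0 hb]] := smooth_mx_bounded sB.
have iDD i j : intg (inner (DA i j) (DA i j)).
  by have [_ /L2_vfield_integrable] := H1A i j.
have iDG i j : intg (inner (DA i j) (grad_mx B i j)).
  by have [_ LD _] := H1A i j; exact: inner_grad_mixed_integrable.
have iGG i j : intg (inner (grad_mx B i j) (grad_mx B i j)).
  exact: inner_grad_integrable.
pose a (x : borelT M) := 2^-1 * \sum_i \sum_j inner (DA i j) (DA i j) x.
pose m (x : borelT M) := \sum_i \sum_j inner (DA i j) (grad_mx B i j) x.
pose g (x : borelT M) := 2^-1 * \sum_i \sum_j inner (grad_mx B i j) (grad_mx B i j) x.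
have ia : intg a by apply: integrableZ_EFin; do 2![apply: integrable_sum_EFin => ?].
have im : intg m by do 2![apply: integrable_sum_EFin => ?].
have ig : intg g by apply: integrableZ_EFin; do 2![apply: integrable_sum_EFin => ?].
pose h (s : R) (x : borelT M) := a x + s * m x + s ^+ 2 * g x + W (A x + s *: B x).
have hE s : along (energy W) A DA B s = (\int[vol M]_x (h s x)%:E)%E.
  apply: eq_integral => x _; congr (_%:E); rewrite /h; congr (_ + _).
  have -> : \sum_i \sum_j inner (fun c p => DA i j c p + s *: grad_mx B i j c p)
        (fun c p => DA i j c p + s *: grad_mx B i j c p) x =
      \sum_i \sum_j inner (DA i j) (DA i j) x + s * (2 * m x)
      + s ^+ 2 * \sum_i \sum_j inner (grad_mx B i j) (grad_mx B i j) x.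
    rewrite /m !mulr_sumr -!big_split; apply: eq_bigr => i _ /=.
    rewrite !mulr_sumr -!big_split; apply: eq_bigr => j _ /=.
    exact: inner_expand.
  by rewrite /a /g; field.
(* For |s| <= 1 one has 1 + |A| + |s B| <= (1 + b)(1 + |A|), so K (1 + |A|)^k bounds the penalty
   quotients uniformly in s. *)
pose K := `|c| * (1 + b) ^+ k * b.
have sb s x : `|s| <= 1 -> `|s *: B x| <= `|s| * b.
  by move=> s1; rewrite normrZ ler_wpM2l.
have WL s x : `|s| <= 1 ->
    `|W (A x + s *: B x) - W (A x)| <= `|s| * (K * (1 + `|A x|) ^+ k).
  move=> s1; rewrite (le_trans (gW _ _))//.
  apply: (@le_trans _ _
    (`|c| * ((1 + b) ^+ k * (1 + `|A x|) ^+ k) * (`|s| * b))); last first.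
    by rewrite le_eqVlt; apply/orP; left; apply/eqP; rewrite /K; ring.
  apply: (@le_trans _ _ (`|c| * (1 + `|A x| + `|s *: B x|) ^+ k * `|s *: B x|)).
    by rewrite !ler_wpM2r ?ler_norm// exprn_ge0// !addr_ge0.
  have x0 : 0 <= (1 + b) * (1 + `|A x|) by rewrite mulr_ge0// addr_ge0.
  rewrite ler_pM ?sb// ?mulr_ge0 ?exprn_ge0 ?addr_ge0// ler_wpM2l// -exprMn.
  have {}sb : `|s *: B x| <= b by rewrite (le_trans (sb _ _ s1))// ler_piMl.
  case: (k) => // k'; rewrite ler_pXn2r// ?nnegrE ?addr_ge0//.
  have : 0 <= b * `|A x| by rewrite mulr_ge0.
  by move: sb; lra.
(* The majorant: cross term, quadratic term (as s^2 <= |s|) and penalty. *)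
pose q (x : borelT M) := `|m x| + g x + K * (1 + `|A x|) ^+ k.
pose p (x : borelT M) := m x + frob (P x) (B x).
have [ifPB eqPB] := Rintegral_frob iP sB.
have h0 x : h 0 x = a x + W (A x).
  by rewrite /h scale0r addr0 mul0r expr0n /= mul0r !addr0.
have g0 x : 0 <= g x.
  rewrite mulr_ge0// sumr_ge0// => i _; rewrite sumr_ge0// => j _.
  exact: inner_ge0.
have [||||||ih ip dh] := @is_derive_integral_dominated _ _ _ (vol M) h p q.
- move=> s s1; apply: measurable_funD.
    apply: measurable_funD; first apply: measurable_funD.
    + exact: integrable_measurable ia.
    + by apply: measurable_funM => //; exact: integrable_measurable im.
    + by apply: measurable_funM => //; exact: integrable_measurable ig.
  apply: (@measurable_mx_comp _ _ _ _ _ (fun x => A x + s *: B x) W) => // i j.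
  under eq_fun do rewrite !mxE.
  by apply: measurable_funD => //; apply: measurable_funM.
- apply: measurable_funD; first exact: integrable_measurable im.
  exact: integrable_measurable ifPB.
- have -> : h 0 = (fun x => a x + W (A x)) by apply/funext.
  exact: integrableD_EFin.
- apply: integrableD_EFin; last exact: integrableZ_EFin.
  by apply: integrableD_EFin => //; exact: integrable_norm.
- move=> s x s1; rewrite h0 /q.
  have -> : h s x - (a x + W (A x)) =
      s * m x + s ^+ 2 * g x + (W (A x + s *: B x) - W (A x)) by rewrite /h; ring.
  rewrite (le_trans (ler_normD _ _))// mulrDr lerD ?WL//.
  rewrite (le_trans (ler_normD _ _))// mulrDr lerD//; first by rewrite normrM.
  by rewrite normrM (ger0_norm (g0 x)) ler_wpM2r// normrX expr2 ler_piMr.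
- apply: filterS dW => x dWx; rewrite /h.
  apply: is_deriveD (gradient_is_derive (B x) dWx).
  apply/is_derive0P.
  (* At s = 0 the quotient is 0, by the convention that the inverse of 0 is 0; the punctured limit
     ignores this value. *)
  have E : (fun s : R => s^-1 * (a x + s * m x + s ^+ 2 * g x
      - (a x + 0 * m x + 0 ^+ 2 * g x))) =
      (fun s => (if s == 0 then 0 else m x) + s * g x).
    apply/funext => s; have [->|s0] := eqVneq s 0; first by rewrite invr0 !mul0r add0r.
    by field.
  rewrite E.
  have cvs : s * g x @[s --> (0 : R)^'] --> 0 * g x.
    by apply: cvgM; [exact: cvg_within|exact: cvg_cst].
  rewrite -[m x]addr0 -[X in _ + X](mul0r (g x)); apply: cvgD cvs.
  apply: cvg_near_cst; apply: filterS (nbhs_dnbhs_neq (0 : R)) => s /negPf s0.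
  by rewrite s0 mul0r addr0.
have sE : \forall s \near (0 : R), `|s| <= 1 by apply: nbhs0_le.
split.
  apply: filterS sE => s s1; rewrite hE; exact: integrable_fin_num (ih s s1).
have -> : (fun s => fine (along (energy W) A DA B s)) = (fun s => \int[vol M]_x h s x).
  by apply/funext => s; rewrite hE.
have -> : - distr_laplacian_pairing A B + \int[vol M]_x frob (P x) (B x) =
    \int[vol M]_x p x; last by [].
rewrite /p RintegralD//; congr (_ + _).
rewrite /m Rintegral_sum => [|i]; last exact: integrable_sum_EFin.
rewrite /distr_laplacian_pairing -sumrN; apply: eq_bigr => i _.
rewrite Rintegral_sum// -sumrN; apply: eq_bigr => j _.
have [_ _ wD] := H1A i j; rewrite wD//.
exact: grad_smooth.
Qed.
End first_variations.

(** * From first variations to L^2 gradients and flows *)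

Section gradient_flows.
Context {R : realType} {d : nat} {M : closedRiemannianManifold R d} {n : nat}.
Local Notation intg f := ((vol M).-integrable setT (EFin \o (f : borelT M -> R))).
Implicit Types (A B P G L : mfield M n) (DA : mgradient M n).

Lemma smooth_fun_scale (b : M -> R) (c : R) :
  smooth_fun b -> smooth_fun (fun x => b x * c).
Proof.
move=> sb i; apply: (@smooth_onM _ _ _ (b \o psi i) (fun=> c)).
- exact: phi_open.
- exact: sb.
- exact: smooth_on_cst.
Qed.

Lemma laplacian0 (x : M) : laplacian (fun=> 0 : R) x = 0.
Proof.
have g0 : grad (fun=> 0 : R) = (fun _ _ => 0) :> vfield M.
  apply/funext => i; apply/funext => p; rewrite /grad.
  rewrite (_ : \row_k _ = 0) ?mul0mx//; apply/rowP => k; rewrite !mxE.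
  exact: derive_cst.
rewrite /laplacian /div g0 big1 ?mulr0// => k _; rewrite /partial.
rewrite (_ : (fun _ => _) = (fun=> 0)) ?derive_cst//.
by apply/funext => y; rewrite mxE mulr0.
Qed.

Lemma sum_single (F : 'I_n -> 'I_n -> R) i j :
  (forall k l, ((k == i) && (l == j)) = false -> F k l = 0) ->
  \sum_k \sum_l F k l = F i j.
Proof.
move=> F0; rewrite (bigD1 i)//= (bigD1 j)//= big1 ?addr0 => [|l /negbTE lj].
  rewrite big1 ?addr0// => k /negbTE ki; rewrite big1// => l _.
  by rewrite F0// ki.
by rewrite F0// lj andbF.
Qed.

Lemma L2_gradient_iff (E : mfield M n -> mgradient M n -> \bar R) A DA P G :
  integrable_mx P ->
  (forall B, smooth_mx B -> first_variation E A DA B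
     (- distr_laplacian_pairing A B + \int[vol M]_x frob (P x) (B x))) ->
  L2_mx G ->
  is_L2_gradient E A DA G <->
  exists L, distr_laplacian_mx A L /\ {ae vol M, forall x, - G x = L x - P x}.
Proof.
move=> iP fv L2G.
have iG : integrable_mx G by move=> i j; exact: L2_integrable.
split=> [[_ gG]|[L [lapL aeL]]].
  exists (fun x => P x - G x); split; last first.
    by apply: aeW => x; rewrite addrAC subrr sub0r.
  move=> i j; split.
    have := integrableB measurableT (iP i j) (iG i j).
    by apply: eq_integrable => // x _ /=; rewrite !mxE EFinB.
  (* A test field supported on one entry isolates the scalar equation for that entry. *)
  move=> b sb; pose B (x : borelT M) : 'M[R]_n := b x *: delta_mx i j.
  have BE k l : (fun x => B x k l) = (fun x => b x * ((k == i) && (l == j))%:R).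
    by apply/funext => x; rewrite !mxE.
  have sB : smooth_mx B by move=> k l; rewrite BE; exact: smooth_fun_scale.
  (* Two values for the derivative at 0 of the same function of s must agree. *)
  have := @derive_val _ _ _ _ _ _ _ (fv B sB).2.
  rewrite (@derive_val _ _ _ _ _ _ _ (gG B sB).2).
  have -> : distr_laplacian_pairing A B = \int[vol M]_x (A x i j * laplacian b x).
    rewrite /distr_laplacian_pairing (sum_single (i := i) (j := j)).
      apply: eq_Rintegral => x _; rewrite BE !eqxx; congr (_ * laplacian _ x).
      by apply/funext => y; rewrite mulr1.
    move=> k l kl; rewrite (@eq_Rintegral _ _ _ _ _ (cst 0)) ?Rintegral_cst ?mul0r//.
    move=> x _; rewrite BE kl (_ : (fun y => _) = (fun=> 0)) ?laplacian0 ?mulr0//.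
    by apply/funext => y; rewrite mulr0.
  have frobB (Q : mfield M n) :
      \int[vol M]_x frob (Q x) (B x) = \int[vol M]_x (Q x i j * b x).
    by apply: eq_Rintegral => x _; rewrite /B frobZr frob_delta mulrC.
  rewrite !frobB => eqG.
  have ib (Q : mfield M n) : integrable_mx Q -> intg (fun x => Q x i j * b x).
    move=> iQ; have := integrable_mx_mul i j iQ sB.
    by apply: eq_integrable => // x _ /=; rewrite !mxE !eqxx mulr1.
  have -> : \int[vol M]_x ((P x - G x) i j * b x) =
      \int[vol M]_x (P x i j * b x - G x i j * b x).
    by apply: eq_Rintegral => x _; rewrite !mxE mulrBl.
  by rewrite RintegralB//; [rewrite eqG; ring|exact: ib|exact: ib].
split=> // B sB; have := fv B sB.
have [_ ->] := Rintegral_frob iP sB; have [_ ->] := Rintegral_frob iG sB.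
rewrite /distr_laplacian_pairing -sumrN -big_split /=.
under eq_bigr => i _ do rewrite -sumrN -big_split /=.
suff H i j : - (\int[vol M]_x (A x i j * laplacian (fun y => B y i j) x)) +
     (\int[vol M]_x (P x i j * B x i j)) = \int[vol M]_x (G x i j * B x i j).
  by under eq_bigr => i _ do under eq_bigr => j _ do rewrite H.
have [iL lapLij] := lapL i j; rewrite lapLij; last exact: sB.
have iLm : integrable_mx L by move=> k l; have [] := lapL k l.
have iLB := integrable_mx_mul i j iLm sB.
have iPB := integrable_mx_mul i j iP sB.
have iGB := integrable_mx_mul i j iG sB.
rewrite addrC -RintegralB//; apply: ae_eq_Rintegral.
- by apply: measurable_funB;
    [exact: integrable_measurable iPB|exact: integrable_measurable iLB].
- exact: integrable_measurable iGB.
apply: filterS aeL => x GE.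
have -> : G x i j = P x i j - L x i j.
  by have := congr1 (fun Z : 'M[R]_n => Z i j) GE; rewrite !mxE; lra.
by rewrite mulrBl.
Qed.

(** Passing from the formula back to [P] uses that every matrix has a decomposition; otherwise the
    condition over all decompositions could hold vacuously. *)
Lemma L2_gradient_svd_iff (E : mfield M n -> mgradient M n -> \bar R) A DA P
    (F : 'M[R]_n -> 'rV[R]_n -> 'M[R]_n -> 'M[R]_n) :
  integrable_mx P ->
  {ae vol M, forall x U s V, is_svd (A x) U s V -> P x = F U s V} ->
  (forall B, smooth_mx B -> first_variation E A DA B
     (- distr_laplacian_pairing A B + \int[vol M]_x frob (P x) (B x))) ->
  forall G, L2_mx G ->
  is_L2_gradient E A DA G <->
  exists L, distr_laplacian_mx A L /\
    {ae vol M, forall x U s V, is_svd (A x) U s V -> - G x = L x - F U s V}.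
Proof.
move=> iP PF fv G LG; apply: (iff_trans (L2_gradient_iff iP fv LG)).
split=> -[L [lapL aeL]]; exists L; split => //; apply: filterS2 PF aeL => x PFx.
  by move=> -> U s V svdA; rewrite (PFx _ _ _ svdA).
have [U [s [V svdA]]] := svd_exists (A x).
by move=> /(_ _ _ _ svdA) ->; rewrite (PFx _ _ _ svdA).
Qed.

Lemma gradient_flow_iff (E : mfield M n -> mgradient M n -> \bar R)
    (F : 'M[R]_n -> 'rV[R]_n -> 'M[R]_n -> 'M[R]_n) (J : set R)
    (A : R -> mfield M n) (DA : R -> mgradient M n) :
  (forall t, J t -> forall G, L2_mx G ->
     is_L2_gradient E (A t) (DA t) G <->
     exists L, distr_laplacian_mx (A t) L /\
       {ae vol M, forall x U s V, is_svd (A t x) U s V -> - G x = L x - F U s V}) ->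
  gradient_flow E J A DA <->
  forall t, J t -> exists dtA L : mfield M n,
    [/\ time_derivative A t dtA, distr_laplacian_mx (A t) L &
        {ae vol M, forall x U s V, is_svd (A t x) U s V -> dtA x = L x - F U s V}].
Proof.
have L2N (V : mfield M n) : L2_mx V -> L2_mx (fun x => - V x).
  move=> LV i j; have := L2_opp (LV i j); congr (L2 _).
  by apply/funext => x; rewrite mxE.
move=> H; split => flow t Jt.
  have [V [dV gV]] := flow t Jt; have [LV _] := dV.
  have [L [lapL aeL]] := (H t Jt _ (L2N _ LV)).1 gV.
  exists V, L; split => //; apply: filterS aeL => x h U s W /h.
  by rewrite opprK.
have [V [L [dV lapL aeL]]] := flow t Jt; have [LV _] := dV.
exists V; split => //; apply/(H t Jt _ (L2N _ LV)); exists L; split => //.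
by apply: filterS aeL => x h U s W /h; rewrite opprK.
Qed.

(** Gradients are picked pointwise by choice; measurability comes back from difference quotients and
    integrability from the growth bound. Extension by zero off [D] serves the first penalty, with
    [D] the set where the field is nonsingular. *)
Lemma gradient_field (W : 'M[R]_n -> R) (c : R) (k : nat) A (D : set (borelT M)) :
  polynomial_growth W c k ->
  (forall i j, measurable_fun setT (fun x => A x i j)) ->
  intg (fun x => (1 + `|A x|) ^+ k) -> measurable D ->
  (forall x, D x -> exists G : 'M[R]_n, is_gradient W (A x) G) ->
  exists P, integrable_mx P /\ forall x, D x -> is_gradient W (A x) (P x).
Proof.
move=> gW mA iA mD dW.
pose Q x := xget 0 [set G : 'M[R]_n | is_gradient W (A x) G].
have QD x : D x -> is_gradient W (A x) (Q x).
  by move=> /dW[G dG]; exact: xgetI dG.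
exists (Q \_ D); split; last first.
  by move=> x Dx; rewrite patchE mem_set//; exact: QD.
move=> i j; have PE : (fun x => (Q \_ D) x i j) = (fun x => Q x i j) \_ D.
  by apply/funext => x; rewrite !patchE; case: ifP => // _; rewrite mxE.
apply: (@integrable_dominated _ _ _ _ _
    (fun x => (`|c| * 2 ^+ k) * (1 + `|A x|) ^+ k)).
- have mQ := measurable_gradient mA (polynomial_growth_continuous gW) QD i j.
  by rewrite PE; exact: (measurable_restrictT _ mD).1 mQ.
- move=> x; rewrite patchE; case: ifPn => [/set_mem Dx|_]; last first.
    by rewrite mxE normr0 !mulr_ge0// exprn_ge0// addr_ge0.
  rewrite (le_trans (gradient_bound i j gW (QD x Dx)))// -mulrA ler_wpM2l//.
  rewrite -exprMn; case: (k) => // k'.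
  by rewrite ler_pXn2r// ?nnegrE ?mulr_ge0 ?addr_ge0//; have := normr_ge0 (A x); lra.
- exact: integrableZ_EFin.
Qed.
End gradient_flows.

(** * Integrability of the penalties along fields of finite energy *)

Section penalized_energies.
Context {R : realType} {d : nat} {M : closedRiemannianManifold R d} {n : nat}.
Local Notation intg f := ((vol M).-integrable setT (EFin \o (f : borelT M -> R))).
Implicit Types (A : mfield M n) (DA : mgradient M n).

Lemma H1_mx_measurable A DA : H1_mx A DA ->
  forall i j, measurable_fun setT (fun x => A x i j).
Proof. by move=> H1A i j; have [/L2_measurable] := H1A i j. Qed.

Lemma H1_mx_norm_integrable A DA (k : nat) (f : borelT M -> R) : H1_mx A DA ->
  intg f -> (forall x, (1 + `|A x|) ^+ k <= f x) ->
  intg (fun x => (1 + `|A x|) ^+ k).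
Proof.
move=> H1A iF Af; apply: (@integrable_dominated _ _ _ _ _ f) => //.
  apply: measurable_funX; apply: measurable_funD => //.
  apply: (@measurable_mx_comp _ _ _ _ _ A (fun B : 'M[R]_n => `|B|)).
    exact: H1_mx_measurable H1A.
  exact: norm_continuous.
by move=> x; rewrite ger0_norm ?Af// exprn_ge0// addr_ge0.
Qed.

Lemma intg_cst (c : R) : intg (fun=> c).
Proof. by apply: continuous_integrable; exact: cst_continuous. Qed.

Lemma H1_mx_frob_integrable A DA : H1_mx A DA -> intg (fun x => frob (A x) (A x)).
Proof.
move=> H1A; apply: integrable_sum_EFin => i; apply: integrable_sum_EFin => j.
have [/L2_integrable_sqr + _ _] := H1A i j.
by apply: eq_integrable => // x _ /=; rewrite expr2.
Qed.

Lemma mx_norm_le_frob (B : 'M[R]_n) : `|B| ^+ 2 <= frob B B.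
Proof. by apply: mx_norm_sqr_le; [exact: frob_ge0|exact: frob_coord_sqr]. Qed.

Lemma H1_mx_integrable1 A DA : H1_mx A DA -> intg (fun x => (1 + `|A x|) ^+ 1).
Proof.
move=> H1A; apply: (H1_mx_norm_integrable (f := fun x => 2 + frob (A x) (A x)) H1A).
  by apply: integrableD_EFin; [exact: intg_cst|exact: H1_mx_frob_integrable H1A].
move=> x; rewrite expr1; have := mx_norm_le_frob (A x).
by have := sqr_ge0 (`|A x| - 1); rewrite sqrrB1; nra.
Qed.

(** The growth bound started at the zero matrix is quadratic, which square integrability of the
    entries controls. *)
Lemma W1_integrable (eps : R) A DA : H1_mx A DA -> intg (fun x => W1 eps (A x)).
Proof.
move=> H1A; have [c gW] := @W1_growth R n eps.
apply: (@integrable_dominated _ _ _ _ _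
  (fun x => (`|W1 eps (0 : 'M[R]_n)| + `|c|) + 2 * `|c| * frob (A x) (A x))).
- apply: (@measurable_mx_comp _ _ _ _ _ A (W1 eps)).
    exact: H1_mx_measurable H1A.
  exact: polynomial_growth_continuous gW.
- move=> x; have := gW 0 (A x); rewrite expr1 add0r normr0 addr0 => h.
  rewrite -(subrK (W1 eps (0 : 'M[R]_n)) (W1 eps (A x))) addrC.
  rewrite (le_trans (ler_normD _ _))//.
  rewrite -addrA lerD2l (le_trans h)//.
  apply: (@le_trans _ _ (`|c| * ((1 + `|A x|) * `|A x|))).
    by rewrite -mulrA ler_wpM2r ?ler_norm// mulr_ge0// addr_ge0.
  have -> : `|c| + 2 * `|c| * frob (A x) (A x) =
      `|c| * (1 + 2 * frob (A x) (A x)) by ring.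
  rewrite ler_wpM2l//; have := mx_norm_le_frob (A x).
  by have := sqr_ge0 (`|A x| - 1); rewrite sqrrB1; nra.
- apply: integrableD_EFin; first exact: intg_cst.
  by apply: integrableZ_EFin; exact: H1_mx_frob_integrable H1A.
Qed.

(** The diagonal of B^T B consists of the squared column norms, so |B|^2 <= 1 + |Y|. Then (1 +
    |B|)^4 <= 4 (2 + |Y|)^2 <= 24 + 16 |Y|^2, and the squared Frobenius norm of Y is 4 eps^2 times
    the penalty, whence 64. *)
Lemma W2_coercive (eps : R) (B : 'M[R]_n) : 0 < eps ->
  (1 + `|B|) ^+ 3 <= 24 + 64 * eps ^+ 2 * W2 eps B.
Proof.
move=> e0; set Y := B^T *m B - 1%:M.
have WY : frob Y Y = 4 * eps ^+ 2 * W2 eps B.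
  by rewrite /W2 -/Y mulrA divff ?mul1r// mulf_neq0// expf_neq0// gt_eqF.
have b0 : 0 <= `|B| by [].
have y0 : 0 <= `|Y| by [].
have BY : `|B| ^+ 2 <= 1 + `|Y|.
  apply: mx_norm_sqr_le => [|i j]; first exact: addr_ge0.
  apply: (@le_trans _ _ ((B^T *m B) j j)).
    rewrite mxE (bigD1 i)//= mxE -expr2 lerDl sumr_ge0// => k _.
    by rewrite mxE -expr2 sqr_ge0.
  have -> : (B^T *m B) j j = 1 + Y j j.
    have subE (Z : 'M[R]_n) : (Z - 1%:M) j j = Z j j - 1 by rewrite !mxE eqxx.
    by rewrite /Y subE addrC subrK.
  by rewrite lerD2l (le_trans (ler_norm _))// mx_coord_le.
have YF := mx_norm_le_frob Y.
have -> : 24 + 64 * eps ^+ 2 * W2 eps B = 24 + 16 * frob Y Y by rewrite WY; ring.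
apply: (@le_trans _ _ ((1 + `|B|) ^+ 4)).
  by rewrite ler_weXn2l// lerDl.
have h2 : (1 + `|B|) ^+ 2 <= 2 * (1 + `|B| ^+ 2).
  by have := sqr_ge0 (`|B| - 1); rewrite sqrrB1; nra.
have h4 : (1 + `|B|) ^+ 4 <= (2 * (2 + `|Y|)) ^+ 2.
  rewrite (exprM _ 2 2) ler_pXn2r// ?nnegrE ?exprn_ge0 ?mulr_ge0 ?addr_ge0//.
  by rewrite (le_trans h2)// ler_pM2l//; lra.
rewrite (le_trans h4)//.
by have := sqr_ge0 (`|Y| - 1); rewrite sqrrB1; nra.
Qed.

Lemma measurable_unitmx A DA : H1_mx A DA ->
  measurable [set x : borelT M | A x \in unitmx].
Proof.
move=> H1A.
have -> : [set x : borelT M | A x \in unitmx] =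
    (fun x => \det (A x)) @^-1` (~` [set 0]).
  apply/seteqP; split => x /=; rewrite unitmxE unitfE; first by move/eqP.
  by move=> h; apply/eqP.
rewrite -[X in measurable X]setTI.
have : measurable_fun setT (fun x => \det (A x)).
  apply: measurable_sum => s; apply: measurable_funM => //.
  by apply: measurable_prod => i _; exact: H1_mx_measurable H1A _ _.
by apply => //; exact: measurableC.
Qed.

Lemma W2_integrable (eps : R) A DA : H1_mx A DA -> (E2 eps A DA < +oo)%E ->
  intg (fun x => W2 eps (A x)).
Proof.
move=> H1A EA.
have [c gW] := @W2_growth R n eps.
have D0 x : 0 <= 2^-1 * \sum_i \sum_j inner (DA i j) (DA i j) x.
  rewrite mulr_ge0// sumr_ge0// => i _; rewrite sumr_ge0// => j _; exact: inner_ge0.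
apply/integrableP; split.
  apply/measurable_EFinP.
  apply: (@measurable_mx_comp _ _ _ _ _ A (W2 eps)).
    exact: H1_mx_measurable H1A.
  exact: polynomial_growth_continuous gW.
apply: le_lt_trans EA; apply: le_integral_ge0 => x; first exact: abse_ge0.
by rewrite /= lee_fin ger0_norm ?W2_ge0// lerDr.
Qed.
End penalized_energies.

(** * The penalty gradient fields of the two energies *)

Section main.
Context {R : realType} {d : nat} {M : closedRiemannianManifold R d} {n : nat}.
Local Notation intg f := ((vol M).-integrable setT (EFin \o (f : borelT M -> R))).

Lemma E1_field (eps : R) (A : mfield M n) (DA : mgradient M n) :
  H1_mx A DA -> {ae vol M, forall x, A x \in unitmx} ->
  exists P : mfield M n,
    [/\ integrable_mx P,
        {ae vol M, forall x, forall U s V, is_svd (A x) U s V ->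
           P x = eps ^- 2 *: (U *m (diag_mx s - 1%:M) *m V^T)} &
        forall B, smooth_mx B -> first_variation (E1 eps) A DA B
          (- distr_laplacian_pairing A B + \int[vol M]_x frob (P x) (B x))].
Proof.
move=> H1A uA.
have [c gW] := @W1_growth R n eps.
have iA := H1_mx_integrable1 H1A.
have [P [iP dP]] := gradient_field gW (H1_mx_measurable H1A) iA (measurable_unitmx H1A)
  (fun x (ux : A x \in unitmx) => let: ex_intro U (ex_intro s (ex_intro V svdA)) :=
     svd_exists (A x) in ex_intro _ _ (W1_gradient eps ux svdA)).
exists P; split => //.
  apply: filterS uA => x ux U s V svdA.
  exact: gradient_unique (dP x ux) (W1_gradient eps ux svdA).
move=> B sB; apply: (first_variation_energy gW) => //; first exact: W1_integrable H1A.
by apply: filterS uA => x ux; exact: dP.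
Qed.

Lemma E2_field (eps : R) (A : mfield M n) (DA : mgradient M n) :
  0 < eps -> H1_mx A DA -> (E2 eps A DA < +oo)%E ->
  exists P : mfield M n,
    [/\ integrable_mx P,
        {ae vol M, forall x, forall U s V, is_svd (A x) U s V ->
           P x = eps ^- 2 *:
             (U *m (diag_mx s *m diag_mx s - 1%:M) *m diag_mx s *m V^T)} &
        forall B, smooth_mx B -> first_variation (E2 eps) A DA B
          (- distr_laplacian_pairing A B + \int[vol M]_x frob (P x) (B x))].
Proof.
move=> eps_gt0 H1A EA.
have [c gW] := @W2_growth R n eps.
have iW := W2_integrable H1A EA.
have iA : intg (fun x => (1 + `|A x|) ^+ 3).
  apply: (H1_mx_norm_integrable (f := fun x => 24 + 64 * eps ^+ 2 * W2 eps (A x)) H1A).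
    by apply: integrableD_EFin; [exact: intg_cst|exact: integrableZ_EFin].
  by move=> x; exact: W2_coercive.
have [P [iP dP]] := gradient_field gW (H1_mx_measurable H1A) iA measurableT
  (fun x _ => ex_intro _ _ (W2_gradient eps (A x))).
exists P; split => //.
  apply: aeW => x U s V svdA; rewrite -(W2_grad_svd eps svdA).
  exact: gradient_unique (dP x I) (W2_gradient eps (A x)).
move=> B sB; apply: (first_variation_energy gW) => //.
by apply: aeW => x; exact: dP.
Qed.
End main.

Theorem theorem3p1 (R : realType) (d : nat) (Omega : closedRiemannianManifold R d)
    (n : nat) (eps : R) (eps_gt0 : 0 < eps) :
  (* (1) *)
  [/\ (forall A : 'M[R]_n, A \in unitmx ->
         exists! P : 'M[R]_n, exists U s V, is_svd A U s V /\
           P = eps ^- 2 *: (U *m (diag_mx s - 1%:M) *m V^T)),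
      (forall (A : 'M[R]_n) U s V, A \in unitmx -> is_svd A U s V ->
         is_gradient (W1 eps) A (eps ^- 2 *: (U *m (diag_mx s - 1%:M) *m V^T))),
      (forall (A : mfield Omega n) (DA : mgradient Omega n),
         H1_mx A DA -> {ae vol Omega, forall x, A x \in unitmx} ->
         (exists P : mfield Omega n,
            [/\ integrable_mx P,
                {ae vol Omega, forall x, forall U s V, is_svd (A x) U s V ->
                   P x = eps ^- 2 *: (U *m (diag_mx s - 1%:M) *m V^T)} &
                forall B, smooth_mx B ->
                  first_variation (E1 eps) A DA B
                    (- distr_laplacian_pairing A B
                     + \int[vol Omega]_x frob (P x) (B x))]) /\
         (forall G : mfield Omega n, L2_mx G ->
            is_L2_gradient (E1 eps) A DA G <->
            exists L : mfield Omega n, distr_laplacian_mx A L /\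
              {ae vol Omega, forall x, forall U s V, is_svd (A x) U s V ->
                 - G x = L x - eps ^- 2 *: (U *m (diag_mx s - 1%:M) *m V^T)})) &
      (forall (J : set R) (A : R -> mfield Omega n) (DA : R -> mgradient Omega n),
         open J -> is_interval J ->
         (forall t, J t -> H1_mx (A t) (DA t) /\
            {ae vol Omega, forall x, A t x \in unitmx}) ->
         gradient_flow (E1 eps) J A DA <->
         forall t, J t -> exists dtA L : mfield Omega n,
           [/\ time_derivative A t dtA, distr_laplacian_mx (A t) L &
               {ae vol Omega, forall x, forall U s V, is_svd (A t x) U s V ->
                  dtA x = L x - eps ^- 2 *: (U *m (diag_mx s - 1%:M) *m V^T)}])]
  /\
  (* (2) *)
  [/\ (forall A : 'M[R]_n,
         exists! P : 'M[R]_n, exists U s V, is_svd A U s V /\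
           P = eps ^- 2 *: (U *m (diag_mx s *m diag_mx s - 1%:M) *m diag_mx s *m V^T)),
      (forall (A : 'M[R]_n) U s V, is_svd A U s V ->
         is_gradient (W2 eps) A
           (eps ^- 2 *: (U *m (diag_mx s *m diag_mx s - 1%:M) *m diag_mx s *m V^T))),
      (forall (A : mfield Omega n) (DA : mgradient Omega n),
         H1_mx A DA -> (E2 eps A DA < +oo)%E ->
         (exists P : mfield Omega n,
            [/\ integrable_mx P,
                {ae vol Omega, forall x, forall U s V, is_svd (A x) U s V ->
                   P x = eps ^- 2 *: (U *m (diag_mx s *m diag_mx s - 1%:M) *m diag_mx s *m V^T)} &
                forall B, smooth_mx B ->
                  first_variation (E2 eps) A DA B
                    (- distr_laplacian_pairing A B
                     + \int[vol Omega]_x frob (P x) (B x))]) /\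
         (forall G : mfield Omega n, L2_mx G ->
            is_L2_gradient (E2 eps) A DA G <->
            exists L : mfield Omega n, distr_laplacian_mx A L /\
              {ae vol Omega, forall x, forall U s V, is_svd (A x) U s V ->
                 - G x = L x - eps ^- 2 *: (U *m (diag_mx s *m diag_mx s - 1%:M) *m diag_mx s *m V^T)})) &
      (forall (J : set R) (A : R -> mfield Omega n) (DA : R -> mgradient Omega n),
         open J -> is_interval J ->
         (forall t, J t -> H1_mx (A t) (DA t) /\ (E2 eps (A t) (DA t) < +oo)%E) ->
         gradient_flow (E2 eps) J A DA <->
         forall t, J t -> exists dtA L : mfield Omega n,
           [/\ time_derivative A t dtA, distr_laplacian_mx (A t) L &
               {ae vol Omega, forall x, forall U s V, is_svd (A t x) U s V ->
                  dtA x = L x - eps ^- 2 *: (U *m (diag_mx s *m diag_mx s - 1%:M) *m diag_mx s *m V^T)}])].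
Proof.
split; split.
- move=> A uA; have [U [s [V svdA]]] := svd_exists A.
  exists (eps ^- 2 *: (U *m (diag_mx s - 1%:M) *m V^T)); split.
    by exists U, s, V.
  move=> _ [U' [s' [V' [svdA' ->]]]].
  exact: gradient_unique (W1_gradient eps uA svdA) (W1_gradient eps uA svdA').
- by move=> A U s V; exact: W1_gradient.
- move=> A DA H1A uA; have [P PA] := E1_field eps H1A uA.
  by split; [exists P|have [iP svdP fv] := PA; exact: L2_gradient_svd_iff].
- move=> J A DA _ _ HJ; apply: gradient_flow_iff => t Jt.
  have [H1A uA] := HJ t Jt; have [P [iP svdP fv]] := E1_field eps H1A uA.
  exact: L2_gradient_svd_iff.
- move=> A; exists (W2_grad eps A); split.
    have [U [s [V svdA]]] := svd_exists A; exists U, s, V; split => //.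
    exact: W2_grad_svd.
  by move=> _ [U [s [V [svdA ->]]]]; exact: W2_grad_svd.
- by move=> A U s V svdA; rewrite -(W2_grad_svd eps svdA); exact: W2_gradient.
- move=> A DA H1A EA; have [P PA] := E2_field eps_gt0 H1A EA.
  by split; [exists P|have [iP svdP fv] := PA; exact: L2_gradient_svd_iff].
- move=> J A DA _ _ HJ; apply: gradient_flow_iff => t Jt.
  have [H1A EA] := HJ t Jt; have [P [iP svdP fv]] := E2_field eps_gt0 H1A EA.
  exact: L2_gradient_svd_iff.
Qed.
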